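(* Let $\mathbf{X}^*=\mathbf{D}^*\mathbf{A}^*\in\mathbb{R}^{n_1\times n_2}$ with $\mathbf{D}^*\in\mathbb{R}^{n_1\times r}$, $\mathbf{A}^*\in\mathbb{R}^{r\times n_2}$, $r\le n_2$, $\|\mathbf{D}^*\|_{\max}\le 1$, $\|\mathbf{A}^*\|_{\max}\le \mathrm{A}_{\max}$, $\|\mathbf{X}^*\|_{\max}\le \mathrm{X}_{\max}/2$, where $0<\mathrm{A}_{\max}\le n_1\vee n_2$ and $\mathrm{X}_{\max}\ge 1$. Let $m$ be an integer with $4\le m\le n_1n_2$ and $\gamma=m(n_1n_2)^{-1}$. Let the sample set $\mathcal{S}\subseteq[n_1]\times[n_2]$ be drawn from the independent Bernoulli($\gamma$) model, and, given $\mathcal{S}$, let the observations $\mathbf{Y}_{\mathcal{S}}=\{Y_{i,j}\}_{(i,j)\in\mathcal{S}}$ be conditionally independent with joint density (or mass function) $p_{\mathbf{X}^*_{\mathcal{S}}}(\mathbf{Y}_{\mathcal{S}})=\prod_{(i,j)\in\mathcal{S}}p_{X^*_{i,j}}(Y_{i,j})$. Let $\beta\ge 1$, and let $\mathcal{X}$ be any subset of the class $\mathcal{X}'$ of discretized candidates (with parameter $\beta$) defined in the context. If $C_{\mathrm D}$ is any constant satisfying $$C_{\mathrm D}\ \ge\ \max_{\mathbf{X}\in\mathcal{X}}\ \max_{i,j}\ \mathrm{D}(p_{X^*_{i,j}}\|p_{X_{i,j}}),$$ then for any $$\lambda\ \ge\ 2(\beta+2)\left(1+\frac{2C_{\mathrm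 D}}{3}\right)\log(n_1\vee n_2),$$ the complexity penalized maximum likelihood estimator $$\widehat{\mathbf{X}}=\arg\min_{\mathbf{X}=\mathbf{D}\mathbf{A}\in\mathcal{X}}\left\{-\log p_{\mathbf{X}_{\mathcal{S}}}(\mathbf{Y}_{\mathcal{S}})+\lambda\|\mathbf{A}\|_0\right\}$$ satisfies $$\frac{\mathbb{E}_{\mathcal{S},\mathbf{Y}_{\mathcal{S}}}\left[-2\log \mathrm{A}(p_{\widehat{\mathbf{X}}},p_{\mathbf{X}^*})\right]}{n_1n_2}\ \le\ \frac{8C_{\mathrm D}\log m}{m}+3\min_{\mathbf{X}=\mathbf{D}\mathbf{A}\in\mathcal{X}}\left\{\frac{\mathrm{D}(p_{\mathbf{X}^*}\|p_{\mathbf{X}})}{n_1n_2}+\left(\lambda+\frac{4C_{\mathrm D}(\beta+2)\log(n_1\vee n_2)}{3}\right)\left(\frac{n_1r+\|\mathbf{A}\|_0}{m}\right)\right\}.$$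
   Context: Notation: $[n]=\{1,\dots,n\}$; $a\vee b=\max\{a,b\}$; $\log$ is the natural logarithm; $\|\mathbf{M}\|_0$ is the number of nonzero entries of $\mathbf{M}$ and $\|\mathbf{M}\|_{\max}$ the largest absolute value of an entry. In the independent Bernoulli($\gamma$) model each $(i,j)\in[n_1]\times[n_2]$ is included in $\mathcal{S}$ independently with probability $\gamma$. $\{p_x\}$ is a given family of probability densities (or probability mass functions) of a real-valued random variable, parameterized by a real number $x$. For a matrix $\mathbf{X}$, $p_{\mathbf{X}_{\mathcal{S}}}(\mathbf{Y}_{\mathcal{S}})=\prod_{(i,j)\in\mathcal{S}}p_{X_{i,j}}(Y_{i,j})$. The KL divergence is $\mathrm{D}(p\|q)=\mathbb{E}_p[\log(p(Y)/q(Y))]$ and the Hellinger affinity is $\mathrm{A}(p,q)=\mathbb{E}_p[\sqrt{q(Y)/p(Y)}]$. For matrices, $\mathrm{D}(p_{\mathbf{X}}\|p_{\widetilde{\mathbf{X}}})=\sum_{i,j}\mathrm{D}(p_{X_{i,j}}\|p_{\widetilde X_{i,j}})$ and $\mathrm{A}(p_{\mathbf{X}},p_{\widetilde{\mathbf{X}}})=\prod_{i,j}\mathrm{A}(p_{X_{i,j}},p_{\widetilde X_{i,j}})$, over all $(i,j)\in[n_1]\times[n_2]$. Candidate class: for $\beta\ge1$ set $L_{\rm lev}=2^{\lceil\log_2 (n_1\vee n_2)^{\beta}\rceil}$. Let $\mathcal{D}$ be the set of all matrices $\mathbf{D}\in\mathbb{R}^{n_1\times r}$ whose entries each take one of $L_{\rm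 lev}$ uniformly-spaced levels in $[-1,1]$, and let $\mathcal{A}$ be the set of all $\mathbf{A}\in\mathbb{R}^{r\times n_2}$ whose entries are each either zero or one of $L_{\rm lev}$ uniformly-spaced levels in $[-\mathrm{A}_{\max},\mathrm{A}_{\max}]$. Then $\mathcal{X}'=\{\mathbf{X}=\mathbf{D}\mathbf{A}:\mathbf{D}\in\mathcal{D},\ \mathbf{A}\in\mathcal{A},\ \|\mathbf{X}\|_{\max}\le \mathrm{X}_{\max}\}$. Minimization ''over $\mathbf{X}=\mathbf{D}\mathbf{A}\in\mathcal{X}$'' means over pairs $(\mathbf{D},\mathbf{A})\in\mathcal{D}\times\mathcal{A}$ with $\mathbf{D}\mathbf{A}\in\mathcal{X}$; $\widehat{\mathbf X}$ is the product of a minimizing pair. *)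

(* Defs.v *)
From HB Require Import structures.
From mathcomp Require Import all_boot all_order all_algebra.
From mathcomp Require Import all_classical all_reals all_analysis.

Set Implicit Arguments.
Unset Strict Implicit.
Unset Printing Implicit Defensive.

Import Order.TTheory GRing.Theory Num.Theory.
Import numFieldNormedType.Exports.

Local Open Scope classical_set_scope.
Local Open Scope ring_scope.

Section Densities.
Context {R : realType}.
Implicit Types (mu : {measure set R -> \bar R}) (f g : R -> R).

(* Densities are taken with respect to an arbitrary reference measure [mu]:
   [lebesgue_measure] gives probability density functions and [counting]
   gives probability mass functions. *)
Definition is_density mu f : Prop :=
  [/\ measurable_fun [set: R] f, (forall y, 0 <= f y)
    & (\int[mu]_y (f y)%:E = 1)%E].

(* Since [0 * x = 0] in [\bar R], also for infinite [x], the points where [f]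
   vanishes do not contribute. *)
Definition expect mu f (h : R -> \bar R) : \bar R :=
  (\int[mu]_y ((f y)%:E * h y))%E.

(* The logarithm and the division are the extended ones: the log-ratio is
   [+oo] where [f y > 0] and [g y = 0]. *)
Definition KL mu f g : \bar R :=
  expect mu f (fun y => lne ((f y)%:E / (g y)%:E))%E.

Definition affinity mu f g : \bar R :=
  expect mu f (fun y => (Num.sqrt (g y / f y))%:E).

Definition KL_mx mu (p : R -> R -> R) n1 n2 (X X' : 'M[R]_(n1, n2)) : \bar R :=
  (\sum_(i < n1) \sum_(j < n2) KL mu (p (X i j)) (p (X' i j)))%E.

Definition affinity_mx mu (p : R -> R -> R) n1 n2 (X X' : 'M[R]_(n1, n2)) :
    \bar R :=
  (\prod_(i < n1) \prod_(j < n2) affinity mu (p (X i j)) (p (X' i j)))%E.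

Definition likelihood (p : R -> R -> R) n1 n2 (X : 'M[R]_(n1, n2))
    (s : {set 'I_n1 * 'I_n2}) (y : 'I_n1 -> 'I_n2 -> R) : R :=
  \prod_(e in s) p (X e.1 e.2) (y e.1 e.2).

End Densities.

Section Sampling.
Context {R : realType} {d : measure_display} {T : measurableType d}.
Variable P : probability T R.

Definition independent_events (I : finType) (E : I -> set T) : Prop :=
  forall J : {set I}, P (\bigcap_(i in [set` J]) E i) = (\prod_(i in J) P (E i))%E.

Definition bernoulli_sampling (I : finType) (gamma : R) (S : T -> {set I}) :
    Prop :=
  [/\ forall i, measurable [set w | i \in S w],
      forall i, P [set w | i \in S w] = gamma%:E
    & independent_events (fun i => [set w | i \in S w])].

(* Given [S = s], the [Y i j] with [(i, j) \in s] are independent with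
   densities [p (X i j)]. Both sides are multiplied by the probability of
   [S = s], so that nothing is required if it is zero; nor is anything required
   of the [Y i j] with [(i, j)] outside [S], which are not observed. *)
Definition conditional_density (mu : {measure set R -> \bar R})
    (p : R -> R -> R) n1 n2 (X : 'M[R]_(n1, n2))
    (S : T -> {set 'I_n1 * 'I_n2}) (Y : 'I_n1 -> 'I_n2 -> {RV P >-> R}) : Prop :=
  forall (s : {set 'I_n1 * 'I_n2}) (B : 'I_n1 -> 'I_n2 -> set R),
    (forall i j, measurable (B i j)) ->
    P [set w | S w = s /\ forall i j, (i, j) \in s -> B i j (Y i j w)] =
    (P [set w | S w = s] *
     \prod_(e in s) \int[mu]_(y in B e.1 e.2) (p (X e.1 e.2) y)%:E)%E.

End Sampling.

Section Candidates.
Context {R : realType}.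

Definition nnz m n (M : 'M[R]_(m, n)) : nat :=
  #|[set e : 'I_m * 'I_n | M e.1 e.2 != 0]|.

(* For [1 <= maxn n1 n2] and [0 <= beta] the ceiling is nonnegative, so the
   absolute value only converts it to a natural number. *)
Definition Llev (n1 n2 : nat) (beta : R) : nat :=
  2 ^ `|Num.ceil (ln ((maxn n1 n2)%:R `^ beta) / ln 2)|%N.

(* [G] consists of [L] uniformly-spaced levels in [[-b, b]]; whether the
   end points are levels is left open. *)
Definition uniform_levels (L : nat) (b : R) (G : set R) : Prop :=
  exists a h : R, [/\ 0 < h, G = [set a + k%:R * h | k in `I_L]
                    & G `<=` `[- b, b]].

Definition factors n1 n2 r (GD GA : set R) :
    set ('M[R]_(n1, r) * 'M[R]_(r, n2)) :=
  [set DA : 'M[R]_(n1, r) * 'M[R]_(r, n2) |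
     (forall i k, GD (DA.1 i k)) /\
     (forall k j, DA.2 k j = 0 \/ GA (DA.2 k j))].

Definition candidates n1 n2 r (GD GA : set R) (Xmax : R) :
    set 'M[R]_(n1, n2) :=
  [set X | (exists2 DA, @factors n1 n2 r GD GA DA & X = DA.1 *m DA.2) /\
           mx_norm X <= Xmax].

Definition feasible n1 n2 r (GD GA : set R) (Xs : set 'M[R]_(n1, n2)) :
    set ('M[R]_(n1, r) * 'M[R]_(r, n2)) :=
  [set DA : 'M[R]_(n1, r) * 'M[R]_(r, n2) |
     factors GD GA DA /\ Xs (DA.1 *m DA.2)].

Definition argmin_on {U : Type} (A : set U) (f : U -> \bar R) (x : U) : Prop :=
  A x /\ forall y, A y -> (f x <= f y)%E.

Definition objective (p : R -> R -> R) (lambda : R) n1 n2 r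
    (s : {set 'I_n1 * 'I_n2}) (y : 'I_n1 -> 'I_n2 -> R)
    (DA : 'M[R]_(n1, r) * 'M[R]_(r, n2)) : \bar R :=
  (- lne (likelihood p (DA.1 *m DA.2) s y)%:E
   + (lambda * (nnz DA.2)%:R)%:E)%E.

End Candidates.

(* Main.v *)
Require Import Defs.
From HB Require Import structures.
From mathcomp Require Import all_boot all_order all_algebra.
From mathcomp Require Import all_classical all_reals all_analysis.
From mathcomp Require Import measurable_realfun unstable ring lra.

Set Implicit Arguments.
Unset Strict Implicit.
Unset Printing Implicit Defensive.

Import Order.TTheory GRing.Theory Num.Theory.
Import numFieldNormedType.Exports.

Local Open Scope classical_set_scope.
Local Open Scope ring_scope.

(** Write [D] and [A] for the divergence and the affinity, [gamma = m / (n1 n2)] and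
    [L_X] for the log-likelihood ratio of [Xstar] to [X] over the sample. No
    concentration inequality is needed: with [theta = 1 / (1 + 2 CD / 3)] the variable
    [exp (- theta L_X / 2 - (theta / 3) gamma log A(X))] has mean at most 1. Indeed, by
    independence and Jensen's inequality its mean is at most
    [prod_e (1 - gamma (1 - A_e ^ theta)) A_e ^ (- theta gamma / 3)], and
    [1 - exp (- x) >= x / 3] for [x = - theta log A_e], which lies in [[0, 3/4]] since
    [- 2 log A_e <= D_e <= CD].
    The weights [(n1 \/ n2) ^ (- (beta + 2) (n1 r + nnz A))] satisfy Kraft's inequality,
    so the weighted sum of these variables over all candidates also has mean at most 1.
    It dominates its term at the estimator; taking logarithms ([t <= exp t - 1]),
    comparing the estimator with a fixed candidate [X] through the argmin property, and
    using [E L_X = gamma D(X)], one gets the bound, even without its [log m / m] term. *)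

(** * Integrals against a density *)

Section Integration.
Context {R : realType}.
Import HBNNSimple.

(** Replacing [f] by the pointwise minimum of [f] and [g] changes it only on a null set and makes
    the inequality hold everywhere; the minimum is integrable since [|f| + |g|] dominates it. *)
Lemma ae_le_integral {d} {T : measurableType d}
    (mu : {measure set T -> \bar R}) (f g : T -> \bar R) :
  mu.-integrable setT f -> mu.-integrable setT g ->
  {ae mu, forall x, (f x <= g x)%E} -> (\int[mu]_x f x <= \int[mu]_x g x)%E.
Proof.
move=> intf intg fg.
have mf := measurable_int mu intf; have mg := measurable_int mu intg.
rewrite (@ae_eq_integral _ _ _ mu setT (fun x => mine (f x) (g x)) f) //.
- apply: le_integral => //; last by move=> x _; rewrite ge_min lexx orbT.
  apply: (le_integrable measurableT (measurable_mine mf mg)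
    _ (integrableD measurableT (integrable_abse intf) (integrable_abse intg))).
  move=> x _ /=; rewrite [leRHS]gee0_abs ?adde_ge0//.
  by rewrite minEle; case: ifP => _; rewrite ?leeDl ?leeDr.
- exact: measurable_mine.
- apply: filterS fg => x /= fg _.
  by rewrite minEle fg.
Qed.

Section Weighted.
Context {d : measure_display} {T : measurableType d}.
Variables (mu : {measure set T -> \bar R}) (g : T -> R).
Hypotheses (mg : measurable_fun setT g) (g0 : forall x, 0 <= g x).

Lemma integral_nnsfunM d' (T' : measurableType d') (Y : T -> T')
    (h : {nnsfun T' >-> R}) : measurable_fun setT Y ->
  (\int[mu]_x (g x * h (Y x))%:E =
   \sum_(r \in range h)
      r%:E * \int[mu]_x (g x * \1_(h @^-1` [set r]) (Y x))%:E)%E.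
Proof.
move=> mY.
have mgI r : measurable_fun setT
    (fun x => (g x * \1_(h @^-1` [set r]) (Y x))%:E).
  apply/measurable_EFinP; apply: measurable_funM => //.
  by apply: measurableT_comp => //; exact: measurable_indic.
under eq_integral.
  move=> x _; rewrite fimfunE EFinM -fsumEFin// ge0_mule_fsumr; last first.
    by move=> r; rewrite EFinM nnfun_muleindic_ge0.
  under eq_fsbigr do rewrite [X in (_ * X)%E]EFinM muleCA -EFinM.
  over.
rewrite ge0_integral_fsum//; last 2 first.
- move=> r; apply/measurable_EFinP; apply: measurable_funM => //.
  exact/measurable_EFinP/mgI.
- move=> r x _; rewrite EFinM EFinM muleCA mule_ge0//.
    by rewrite lee_fin.
  by rewrite nnfun_muleindic_ge0.
apply: eq_fsbigr => r /set_mem[y _ <-].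
under eq_integral do rewrite EFinM.
by rewrite ge0_integralZl ?lee_fin// => x _; rewrite lee_fin mulr_ge0.
Qed.

Lemma cvg_integral_approxM d' (T' : measurableType d') (Y : T -> T')
    (h : T' -> R) (mh : measurable_fun setT (EFin \o h)) :
  measurable_fun setT Y -> (forall x, 0 <= h x) ->
  (\int[mu]_x (g x * nnsfun_approx measurableT mh n (Y x))%:E @[n --> \oo] -->
   \int[mu]_x (g x * h (Y x))%:E)%E.
Proof.
move=> mY h0.
rewrite (_ : (\int[mu]_x (g x * h (Y x))%:E = \int[mu]_x limn (fun n =>
  (g x * nnsfun_approx measurableT mh n (Y x))%:E))%E); last first.
  apply: eq_integral => x _; apply/esym/cvg_lim => //.
  rewrite EFinM; under eq_fun do rewrite EFinM.
  apply: cvgeZl => //.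
  by apply: (cvg_nnsfun_approx measurableT mh) => // t _; rewrite lee_fin.
apply: cvg_monotone_convergence => //.
- move=> n; apply/measurable_EFinP; apply: measurable_funM => //.
  exact: measurableT_comp.
- by move=> n x _; rewrite lee_fin mulr_ge0.
- move=> x _ n m nm; rewrite lee_fin ler_wpM2l//.
  exact/lefP/nd_nnsfun_approx.
Qed.

End Weighted.

(** Agreement on indicators extends to simple functions by linearity, then to [h] by monotone
    convergence along one common sequence of simple functions. This transfers integrals over the
    sample space to integrals against a density. *)
Lemma eq_integral_density d1 (T1 : measurableType d1)
    (mu1 : {measure set T1 -> \bar R}) d2 (T2 : measurableType d2)
    (mu2 : {measure set T2 -> \bar R}) d' (T' : measurableType d')
    (g1 : T1 -> R) (g2 : T2 -> R) (Y1 : T1 -> T') (Y2 : T2 -> T')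
    (h : T' -> R) :
  measurable_fun setT g1 -> measurable_fun setT g2 ->
  (forall x, 0 <= g1 x) -> (forall x, 0 <= g2 x) ->
  measurable_fun setT Y1 -> measurable_fun setT Y2 ->
  measurable_fun setT h -> (forall x, 0 <= h x) ->
  (forall B, measurable B -> (\int[mu1]_x (g1 x * \1_B (Y1 x))%:E =
     \int[mu2]_x (g2 x * \1_B (Y2 x))%:E)%E) ->
  (\int[mu1]_x (g1 x * h (Y1 x))%:E = \int[mu2]_x (g2 x * h (Y2 x))%:E)%E.
Proof.
move=> mg1 mg2 g10 g20 mY1 mY2 /measurable_EFinP mh h0 g12.
have := cvg_integral_approxM (mu := mu1) mg1 g10 mh mY1 h0.
under eq_fun.
  move=> n; rewrite integral_nnsfunM//.
  under eq_fsbigr do rewrite g12//.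
  rewrite -integral_nnsfunM//; over.
move=> /cvg_lim <-//; apply: cvg_lim => //; exact: cvg_integral_approxM.
Qed.

End Integration.

(** * Bernoulli sampling *)

Section Sampling.
Context {R : realType} {d : measure_display} {T : measurableType d}.
Variable P : probability T R.

Lemma measurable_prod_cond (I : finType) (Q : pred I) (h : I -> T -> R) :
  (forall i, measurable_fun setT (h i)) ->
  measurable_fun setT (fun w => \prod_(i | Q i) h i w).
Proof.
move=> mh; under eq_fun do rewrite -big_filter.
exact: measurable_prod.
Qed.

(** * Products over a Bernoulli sample *)

Section Bernoulli.
Context {I : finType}.
Variable S : T -> {set I}.

(** Expands the product over all [i] of [1 + (i \in A) * (M i - 1)]. Only inclusion events
    [J \subset A] appear, and these are the events whose probabilities independence provides. *)
Lemma prod_mem_split (M : I -> R) (A : {set I}) :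
  \prod_(i in A) M i =
  \sum_(J : {set I}) (\prod_(i in J) (M i - 1)) * (J \subset A)%:R.
Proof.
rewrite big_mkcond/= (eq_bigr (fun i => (i \in A)%:R * (M i - 1) + 1)); last first.
  by move=> i _; case: ifP => _; rewrite ?mul1r ?mul0r ?add0r ?subrK.
rewrite bigA_distr; apply: eq_big => [J|J _]; first by rewrite inE.
rewrite -big_mkcond/= big_split/= mulrC; congr (_ * _).
have [JA|] := boolP (J \subset A).
  by rewrite big1// => i /(fintype.subsetP JA) ->.
by move=> /fintype.subsetPn[i iJ iA]; rewrite (bigD1 i)//= (negbTE iA) mul0r.
Qed.

Hypothesis mS : forall i, measurable [set w | i \in S w].

Lemma measurable_sample s : measurable [set w | S w = s].
Proof.
rewrite (_ : [set w | S w = s] = \bigcap_(i in [set: I])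
  (if i \in s then [set w | i \in S w] else ~` [set w | i \in S w])).
  apply: fin_bigcap_measurable => // i _.
  by case: ifP => _ //; apply: measurableC.
apply/seteqP; split => w /=.
  move=> <- i _; case: ifPn => //=.
  by move=> /negP.
move=> h; apply/setP => i; have := h i Logic.I.
by case: ifPn => [_ ->|_ /negP/negbTE].
Qed.

(** After the expansion over subsets [J], each inclusion event has probability [gamma] to the power
    [#|J|]; the sum then folds back into a product by distributivity. *)
Lemma integral_sample_prod gamma (M : I -> R) :
  (forall i, P [set w | i \in S w] = gamma%:E) ->
  independent_events P (fun i => [set w | i \in S w]) ->
  (\int[P]_w (\prod_(i in S w) M i)%:E = (\prod_i (1 + gamma * (M i - 1)))%:E)%E.
Proof.
move=> hP hI.
have subE (J : {set I}) w : ((J \subset S w)%:R : R) =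
    \1_(\bigcap_(i in [set` J]) [set w | i \in S w]) w.
  rewrite indicE; congr ((nat_of_bool _)%:R).
  apply/idP/idP => [JS|/set_mem h].
    by apply/mem_set => i /=; exact: (fintype.subsetP JS).
  by apply/fintype.subsetP => i; exact: h.
have mJ (J : {set I}) : measurable (\bigcap_(i in [set` J]) [set w | i \in S w]).
  by apply: fin_bigcap_measurable.
under eq_integral.
  move=> w _; rewrite prod_mem_split -sumEFin.
  under eq_bigr do rewrite subE EFinM.
  over.
rewrite integral_sum//=; last first.
  by move=> J; apply: integrableZl => //; apply: integrable_indic => //;
    rewrite -ge0_fin_numE// fin_num_measure.
transitivity (\sum_(J : {set I}) (\prod_(i in J) (gamma * (M i - 1)))%:E)%E.
  apply: eq_bigr => J _.
  rewrite integralZl//; last first.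
    by apply: integrable_indic => //; rewrite -ge0_fin_numE// fin_num_measure.
  rewrite integral_indic// setIT.
  under [X in (_ = X%:E)%E]eq_bigr do rewrite mulrC.
  rewrite big_split/= EFinM; congr (_ * _)%E; apply: etrans (hI J) _.
  by rewrite -prodEFin; apply: eq_bigr => i _; exact: hP.
rewrite sumEFin; congr EFin.
under [RHS]eq_bigr do rewrite addrC.
rewrite bigA_distr; apply: eq_big => [J|J _]; first by rewrite inE.
by rewrite -big_mkcond.
Qed.

End Bernoulli.

(** * Expectations of functions of the observed entries *)

Section Observations.
Context {n1 n2 : nat}.
Notation E := ('I_n1 * 'I_n2)%type.
Variables (mu : {measure set R -> \bar R}) (p : R -> R -> R).
Hypothesis hp : forall x, is_density mu (p x).
Variables (X : 'M[R]_(n1, n2)) (S : T -> {set E}).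
Variable Y : 'I_n1 -> 'I_n2 -> {RV P >-> R}.
Hypothesis mS : forall i, measurable [set w | i \in S w].
Hypothesis hY : conditional_density mu p X S Y.

(** The conditional density hypothesis in integral form: the product of indicators is the indicator
    of the event [D] below. *)
Lemma integral_sample_indic s (B : E -> set R) :
  (forall e, measurable (B e)) ->
  (\int[P]_w (\1_[set w | S w = s] w *
     \prod_(e in s) \1_(B e) (Y e.1 e.2 w))%:E =
   (P [set w | S w = s] *
    \prod_(e in s) \int[mu]_y (p (X e.1 e.2) y * \1_(B e) y)%:E))%E.
Proof.
move=> mB.
have := @hY s (fun i j => B (i, j)) (fun i j => mB _).
set D := [set w | _ /\ _].
have DE : D = [set w | S w = s] `&`
    \bigcap_(e in [set` s]) (Y e.1 e.2 @^-1` B e).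
  apply/seteqP; split => w [Sw h]; split => //.
    by move=> [i j] /= es; exact: h.
  by move=> i j es; exact: (h (i, j)).
have mD : measurable D.
  rewrite DE; apply: measurableI; first exact: measurable_sample.
  apply: fin_bigcap_measurable => // e _.
  by rewrite -[X in measurable X]setTI; exact: measurable_funPT.
transitivity (P D).
  transitivity (\int[P]_w (\1_D w)%:E)%E; last by rewrite integral_indic// setIT.
  apply: eq_integral => w _; congr EFin; rewrite DE indicI/=; congr (_ * _).
  rewrite indicE; have [/set_mem h|/negP h] := boolP (w \in _).
    by rewrite big1// => e es; rewrite indicE mem_set//; exact: h.
  have [e es We] : exists2 e, e \in s & ~ B e (Y e.1 e.2 w).
    apply: contrapT => h'; apply: h; apply/mem_set => e es.
    by apply: contrapT => h; apply: h'; exists e.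
  by rewrite (bigD1 e)//= indicE memNset// mul0r.
apply: etrans (hY s (fun i j => mB (i, j))) _.
congr (_ * _)%E; apply: eq_bigr => -[i j] _ /=.
rewrite integral_mkcond; apply: eq_integral => y _.
by rewrite patchE indicE; case: ifPn => _; rewrite ?mulr1 ?mulr0.
Qed.

Lemma integral_sample_likelihood s (H : E -> R -> R) (M : E -> R) :
  (forall e, measurable_fun setT (H e)) -> (forall e y, 0 <= H e y) ->
  (forall e, \int[mu]_y (p (X e.1 e.2) y * H e y)%:E = (M e)%:E)%E ->
  (\int[P]_w (\1_[set w | S w = s] w *
     \prod_(e in s) H e (Y e.1 e.2 w))%:E =
   (fine (P [set w | S w = s]) * \prod_(e in s) M e)%:E)%E.
Proof.
move=> mH H0 HM.
(* Induction on a list [l] of the entries at which [H] may be an arbitrary nonnegative function; at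
   the entries of [s] outside [l] it is an indicator. The empty list is the previous lemma, the full
   list the claim. *)
suff: forall l : seq E, forall (H : E -> R -> R) (M : E -> R),
  (forall e, measurable_fun setT (H e)) -> (forall e y, 0 <= H e y) ->
  (forall e, \int[mu]_y (p (X e.1 e.2) y * H e y)%:E = (M e)%:E)%E ->
  (forall e, e \in s -> e \notin l -> exists2 B, measurable B & H e = \1_B) ->
  (\int[P]_w (\1_[set w | S w = s] w *
     \prod_(e in s) H e (Y e.1 e.2 w))%:E =
   (fine (P [set w | S w = s]) * \prod_(e in s) M e)%:E)%E.
  by move=> /(_ (enum s) H M); apply => // e es; rewrite mem_enum es.
move=> l {H M mH H0 HM}.
elim: l => [|e0 l IH] H M mH H0 HM Hl.
  have /choice[B BP] : forall e, exists B, measurable B /\ (e \in s -> H e = \1_B).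
    move=> e; have [/Hl|_] := boolP (e \in s); last by exists setT.
    by move=> /(_ isT)[B mB HB]; exists B.
  have HB e : e \in s -> H e = \1_(B e) by have [_] := BP e.
  under eq_integral.
    move=> w _; under eq_bigr => e es do rewrite HB//.
    over.
  rewrite integral_sample_indic; last by move=> e; have [] := BP e.
  rewrite EFinM fineK ?fin_num_measure//; last exact: measurable_sample.
  rewrite -prodEFin; congr (_ * _)%E; apply: eq_bigr => e es.
  by rewrite -HM HB.
have [e0s|e0s] := boolP (e0 \in s); last first.
  apply: IH => // e es el; apply: Hl => //; rewrite inE negb_or el andbT.
  by apply: contraNneq e0s => <-.
(* All entries but [e0] are frozen into a weight: [g1] on the sample space and the constant [c] on
   the side of the density. Only indicators at [e0] then remain to be compared. *)
pose c := fine (P [set w | S w = s]) * \prod_(e in s | e != e0) M e.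
pose g1 w := \1_[set w | S w = s] w * \prod_(e in s | e != e0) H e (Y e.1 e.2 w).
have p0 x y : 0 <= p x y by have [_] := hp x.
have mp x : measurable_fun setT (p x) by have [] := hp x.
have M0 e : 0 <= M e.
  by rewrite -lee_fin -HM integral_ge0// => y _; rewrite lee_fin mulr_ge0.
have c0 : 0 <= c.
  by rewrite mulr_ge0 ?fine_ge0// prodr_ge0.
have mg1 : measurable_fun setT g1.
  apply: measurable_funM.
    by apply: measurable_indic; exact: measurable_sample.
  by apply: measurable_prod_cond => e; exact: measurableT_comp.
have -> : (\int[P]_w (\1_[set w | S w = s] w *
     \prod_(e in s) H e (Y e.1 e.2 w))%:E)%E =
   (\int[P]_w (g1 w * H e0 (Y e0.1 e0.2 w))%:E)%E.
  apply: eq_integral => w _; rewrite (bigD1 e0)//= /g1; congr EFin.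
  by rewrite mulrCA mulrC -mulrA.
rewrite (@eq_integral_density _ _ _ P _ _ mu _ _ g1
    (fun y => c * p (X e0.1 e0.2) y) (Y e0.1 e0.2) id (H e0))//.
- under eq_integral do rewrite -mulrA EFinM.
  rewrite ge0_integralZl//=.
  + by rewrite HM -EFinM (bigD1 e0)//= /c -mulrA; congr (_ * _)%:E; exact: mulrC.
  + by apply/measurable_EFinP; exact: measurable_funM.
  + by move=> y _; rewrite lee_fin mulr_ge0.
- exact: measurable_funM.
- move=> w; rewrite mulr_ge0//.
  by rewrite prodr_ge0.
- by move=> y; rewrite mulr_ge0.
- move=> B mB.
  (* With an indicator put at [e0], the induction hypothesis for the shorter list applies. *)
  pose H' e := if e == e0 then \1_B else H e.
  pose M' e := if e == e0 then fine (\int[mu]_y (p (X e0.1 e0.2) y * \1_B y)%:E)%E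
    else M e.
  have finB : (\int[mu]_y (p (X e0.1 e0.2) y * \1_B y)%:E)%E \is a fin_num.
    rewrite ge0_fin_numE; last first.
      by apply: integral_ge0 => y _; rewrite lee_fin mulr_ge0//.
    apply: (@le_lt_trans _ _ (\int[mu]_y (p (X e0.1 e0.2) y)%:E)%E).
      apply: ge0_le_integral => //.
      - by move=> y _; rewrite lee_fin mulr_ge0//.
      - by apply/measurable_EFinP; exact: measurable_funM.
      - exact/measurable_EFinP.
      - by move=> y _; rewrite lee_fin ler_piMr// indicE lern1 leq_b1.
    by have [_ _ ->] := hp (X e0.1 e0.2); rewrite ltry.
  transitivity (\int[P]_w (\1_[set w | S w = s] w *
     \prod_(e in s) H' e (Y e.1 e.2 w))%:E)%E.
    apply: eq_integral => w _; rewrite (bigD1 e0)//= /g1; congr EFin.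
    rewrite {1}/H' eqxx -mulrA; congr (_ * _); rewrite mulrC; congr (_ * _).
    by apply: eq_bigr => e /andP[_ /negbTE ee0]; rewrite /H' ee0.
  rewrite (IH H' M').
  + under [RHS]eq_integral do rewrite -mulrA EFinM.
    rewrite ge0_integralZl//=.
    * rewrite -(fineK finB) -EFinM (bigD1 e0)//= {1}/M' eqxx /c -mulrA.
      congr (_ * _)%:E; rewrite mulrC; congr (_ * _).
      by apply: eq_bigr => e /andP[_ /negbTE ee0]; rewrite /M' ee0.
    * by apply/measurable_EFinP; exact: measurable_funM.
    * by move=> y _; rewrite lee_fin mulr_ge0//.
  + by move=> e; rewrite /H'; case: ifP => // _; exact: measurable_indic.
  + by move=> e y; rewrite /H'; case: ifP => // _; rewrite indicE.
  + move=> e; rewrite /H' /M'; case: ifPn => [/eqP ->|_]; last exact: HM.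
    by rewrite fineK.
  + move=> e es el; rewrite /H'; case: ifPn => [_|ee0]; first by exists B.
    by apply: Hl; rewrite // inE negb_or ee0.
Qed.

(** The sample takes finitely many values, so both sides split into sums over [s], which agree term
    by term. The right-hand side depends on the sample alone. *)
Lemma integral_likelihood_sample (H : E -> R -> R) (M : E -> R) :
  (forall e, measurable_fun setT (H e)) -> (forall e y, 0 <= H e y) ->
  (forall e, \int[mu]_y (p (X e.1 e.2) y * H e y)%:E = (M e)%:E)%E ->
  (\int[P]_w (\prod_(e in S w) H e (Y e.1 e.2 w))%:E =
   \int[P]_w (\prod_(e in S w) M e)%:E)%E.
Proof.
move=> mH H0 HM.
have p0 x y : 0 <= p x y by have [_] := hp x.
have M0 e : 0 <= M e.
  by rewrite -lee_fin -HM integral_ge0// => y _; rewrite lee_fin mulr_ge0.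
have sumS (G : {set E} -> R) w :
    G (S w) = \sum_s \1_[set w | S w = s] w * G s.
  rewrite (bigD1 (S w))//= indicE mem_set// mul1r big1 ?addr0// => s sS.
  by rewrite indicE memNset ?mul0r//= => Ss; rewrite Ss eqxx in sS.
have mI s : measurable_fun setT (\1_[set w | S w = s] : T -> R).
  by apply: measurable_indic; exact: measurable_sample.
under eq_integral do rewrite (sumS (fun s => \prod_(e in s) H e (Y e.1 e.2 _))) -sumEFin.
under [RHS]eq_integral do rewrite (sumS (fun s => \prod_(e in s) M e)) -sumEFin.
rewrite !ge0_integral_sum//; last 4 first.
- by move=> s; apply/measurable_EFinP; exact: measurable_funM.
- by move=> s w _; rewrite lee_fin mulr_ge0// prodr_ge0.
- move=> s; apply/measurable_EFinP; apply: measurable_funM => //.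
  by apply: measurable_prod_cond => e; exact: measurableT_comp.
- by move=> s w _; rewrite lee_fin mulr_ge0// prodr_ge0.
apply: eq_bigr => s _; rewrite (integral_sample_likelihood s mH H0 HM).
under eq_integral do rewrite mulrC EFinM.
rewrite ge0_integralZl ?lee_fin ?prodr_ge0//; last exact/measurable_EFinP.
rewrite integral_indic ?setIT//; last exact: measurable_sample.
by rewrite mulrC EFinM fineK// fin_num_measure//; exact: measurable_sample.
Qed.

Variable gamma : R.
Hypothesis hP : forall i, P [set w | i \in S w] = gamma%:E.
Hypothesis hI : independent_events P (fun i => [set w | i \in S w]).

Lemma integral_observed_indic e (B : set R) : measurable B ->
  (\int[P]_w (\1_[set w | e \in S w] w * \1_B (Y e.1 e.2 w))%:E =
   gamma%:E * \int[mu]_y (p (X e.1 e.2) y * \1_B y)%:E)%E.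
Proof.
move=> mB.
have p0 x y : 0 <= p x y by have [_] := hp x.
have mp x : measurable_fun setT (p x) by have [] := hp x.
have p1 x : (\int[mu]_y (p x y)%:E = 1)%E by have [] := hp x.
have fin1 : (\int[mu]_y (p (X e.1 e.2) y * \1_B y)%:E)%E \is a fin_num.
  rewrite ge0_fin_numE; last first.
    by apply: integral_ge0 => y _; rewrite lee_fin mulr_ge0.
  apply: (@le_lt_trans _ _ (\int[mu]_y (p (X e.1 e.2) y)%:E)%E).
    apply: ge0_le_integral => //.
    - by move=> y _; rewrite lee_fin mulr_ge0.
    - by apply/measurable_EFinP; exact: measurable_funM.
    - exact/measurable_EFinP.
    - by move=> y _; rewrite lee_fin ler_piMr// indicE lern1 leq_b1.
  by rewrite p1 ltry.
set b := fine (\int[mu]_y (p (X e.1 e.2) y * \1_B y)%:E)%E.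
(* With this choice the product over the sample is 1 off the event [e \in S w] and the indicator of
   [B] on it. Its mean is [1 + gamma * (b - 1)]; subtracting the probability [1 - gamma] of the
   complement leaves [gamma * b]. *)
pose H e' := if e' == e then \1_B else cst (1 : R).
pose M e' : R := if e' == e then b else 1.
have mH e' : measurable_fun setT (H e').
  by rewrite /H; case: ifP => // _; exact: measurable_indic.
have H0 e' y : 0 <= H e' y by rewrite /H; case: ifP.
have HM e' : (\int[mu]_y (p (X e'.1 e'.2) y * H e' y)%:E = (M e')%:E)%E.
  rewrite /H /M; case: ifPn => [/eqP ->|_]; first by rewrite fineK.
  by under eq_integral do rewrite mulr1; exact: p1.
have := integral_likelihood_sample mH H0 HM.
rewrite (integral_sample_prod mS M hP hI) (bigD1 e)//= big1 ?mulr1; last first.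
  by move=> i /negbTE ie; rewrite /M ie subrr mulr0 addr0.
rewrite /M eqxx.
have HE w : \prod_(e' in S w) H e' (Y e'.1 e'.2 w) =
    \1_(~` [set w | e \in S w]) w + \1_[set w | e \in S w] w * \1_B (Y e.1 e.2 w).
  rewrite !indicE in_setC; have [eS|eS] := boolP (e \in S w).
    rewrite mem_set// add0r mul1r (bigD1 e)//= {1}/H eqxx indicE big1 ?mulr1//.
    by move=> i /andP[_ /negbTE ie]; rewrite /H ie.
  rewrite memNset//= ?mul0r ?addr0; last exact/negP.
  by rewrite big1// => i iS; rewrite /H; case: eqP => // ie; rewrite ie (negbTE eS) in iS.
under eq_integral do rewrite HE EFinD.
have mC : measurable (~` [set w | e \in S w]) by exact: measurableC.
have m1B : measurable_fun setT (fun w => \1_B (Y e.1 e.2 w) : R).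
  by apply: measurableT_comp => //; exact: measurable_indic.
rewrite ge0_integralD//; last 2 first.
- by apply/measurable_EFinP; exact: measurable_indic.
- by apply/measurable_EFinP; apply: measurable_funM => //; exact: measurable_indic.
rewrite integral_indic// setIT.
have PC : P (~` [set w | e \in S w]) = (1 - gamma)%:E.
  by rewrite probability_setC// hP.
rewrite [X in (X + _)%E](_ : _ = (1 - gamma)%:E); last exact: PC.
rewrite -(fineK fin1) -/b -EFinM.
have : (0 <= \int[P]_w (\1_[set w | e \in S w] w * \1_B (Y e.1 e.2 w))%:E)%E.
  by apply: integral_ge0 => w _; rewrite lee_fin mulr_ge0.
case: (\int[P]_w _)%E => // x _; rewrite -EFinD => -[] Hx; congr EFin.
by move: Hx; lra.
Qed.

Lemma integral_observed_ge0 e (h : R -> R) :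
  measurable_fun setT h -> (forall y, 0 <= h y) ->
  (\int[P]_w (\1_[set w | e \in S w] w * h (Y e.1 e.2 w))%:E =
   gamma%:E * \int[mu]_y (p (X e.1 e.2) y * h y)%:E)%E.
Proof.
move=> mh h0.
have p0 x y : 0 <= p x y by have [_] := hp x.
have mp x : measurable_fun setT (p x) by have [] := hp x.
have gamma0 : 0 <= gamma by rewrite -lee_fin -(hP e) measure_ge0.
rewrite -ge0_integralZl ?lee_fin//; last 2 first.
- by apply/measurable_EFinP; exact: measurable_funM.
- by move=> y _; rewrite lee_fin mulr_ge0.
under [RHS]eq_integral do rewrite -EFinM mulrA.
apply: (@eq_integral_density _ _ _ P _ _ mu _ _ _
    (fun y => gamma * p (X e.1 e.2) y) (Y e.1 e.2) id h) => //.
- exact: measurable_funM.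
- by move=> y; rewrite mulr_ge0.
- move=> B mB; rewrite integral_observed_indic//.
  rewrite -ge0_integralZl ?lee_fin//; last 2 first.
  + by apply/measurable_EFinP; apply: measurable_funM => //; exact: measurable_indic.
  + by move=> y _; rewrite lee_fin mulr_ge0.
  by apply: eq_integral => y _; rewrite -EFinM mulrA.
Qed.

(** The nonnegative case is applied to the positive and negative parts of [h]: the weights are
    nonnegative, so they factor out of both parts, and integrability keeps the difference well
    defined. *)
Lemma integral_observed e (h : R -> R) : measurable_fun setT h ->
  mu.-integrable setT (fun y => (p (X e.1 e.2) y * h y)%:E) ->
  P.-integrable setT (fun w => (\1_[set w | e \in S w] w * h (Y e.1 e.2 w))%:E) /\
  (\int[P]_w (\1_[set w | e \in S w] w * h (Y e.1 e.2 w))%:E =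
   gamma%:E * \int[mu]_y (p (X e.1 e.2) y * h y)%:E)%E.
Proof.
move=> mh ih.
have p0 x y : 0 <= p x y by have [_] := hp x.
have gamma0 : 0 <= gamma by rewrite -lee_fin -(hP e) measure_ge0.
have mf : measurable_fun setT
    (fun w => (\1_[set w | e \in S w] w * h (Y e.1 e.2 w))%:E).
  apply/measurable_EFinP; apply: measurable_funM; first exact: measurable_indic.
  exact: measurableT_comp.
split.
  apply/integrableP; split => //.
  under eq_integral do rewrite abse_EFin normrM ger0_norm//.
  rewrite (@integral_observed_ge0 _ (fun y => `|h y|))//; last exact: measurableT_comp.
  have /integrableP[_] := ih.
  under eq_integral do rewrite abse_EFin normrM ger0_norm//.
  by move=> ih'; rewrite lte_mul_pinfty// ?lee_fin.
rewrite integralE [in RHS]integralE.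
have posE (U : Type) (a b : U -> R) : (forall x, 0 <= a x) ->
    ((fun x => (a x * b x)%:E)^\+ = fun x => (a x * Num.max (b x) 0)%:E)%E.
  by move=> a0; apply/funext => x; rewrite funeposE -EFin_max maxr_pMr// mulr0.
have negE (U : Type) (a b : U -> R) : (forall x, 0 <= a x) ->
    ((fun x => (a x * b x)%:E)^\- = fun x => (a x * Num.max (- b x) 0)%:E)%E.
  move=> a0; apply/funext => x.
  by rewrite funenegE -EFinN -EFin_max maxr_pMr// mulr0 mulrN.
have := integrable_pos_fin_num measurableT ih.
have := integrable_neg_fin_num measurableT ih.
rewrite !posE// !negE// => fn fp.
rewrite muleBr//; last exact: fin_num_adde_defr.
by congr (_ - _)%E; [rewrite (@integral_observed_ge0 e (fun y => Num.max (h y) 0))|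
  rewrite (@integral_observed_ge0 e (fun y => Num.max (- h y) 0))] => //;
  (try by move=> y; rewrite le_max lexx orbT);
  apply: measurable_maxr => //; exact: measurable_funN.
Qed.

Lemma ae_observed e (N : set R) : measurable N ->
  (\int[mu]_y (p (X e.1 e.2) y * \1_N y)%:E = 0)%E ->
  {ae P, forall w, e \in S w -> ~ N (Y e.1 e.2 w)}.
Proof.
move=> mN pN0.
have mD : measurable ([set w | e \in S w] `&` Y e.1 e.2 @^-1` N).
  apply: measurableI => //.
  by rewrite -[X in measurable X]setTI; exact: measurable_funPT.
exists ([set w | e \in S w] `&` Y e.1 e.2 @^-1` N); split => //.
  transitivity (\int[P]_w (\1_[set w | e \in S w] w * \1_N (Y e.1 e.2 w))%:E)%E.
    transitivity (\int[P]_w (\1_([set w | e \in S w] `&` Y e.1 e.2 @^-1` N) w)%:E)%E.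
      by rewrite integral_indic// setIT.
    by apply: eq_integral => w _; rewrite indicI.
  by rewrite integral_observed_indic// pN0 mule0.
by move=> w /= /not_implyP[eS /contrapT NY].
Qed.

End Observations.
End Sampling.

(** * Divergence and affinity of two densities *)

Section Densities.
Context {R : realType}.
Variables (mu : {measure set R -> \bar R}).
Implicit Types f g : R -> R.

(** The graph of a concave power lies below its tangent at [a]. After division by [a], this is
    concavity of [ln] between [x / a] and 1. Integrated with [a] the mean, it gives Jensen's
    inequality. *)
Lemma powR_le_tangent (a x theta : R) : 0 < a -> 0 <= x -> 0 < theta <= 1 ->
  x `^ theta <= a `^ theta * (1 - theta + theta * (x / a)).
Proof.
move=> a0 x0 /andP[t0 t1].
have [->|x_neq0] := eqVneq x 0.
  by rewrite powR0 ?gt_eqF// mulr_ge0 ?powR_ge0// mul0r mulr0 addr0 subr_ge0.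
have xpos : 0 < x by rewrite lt_neqAle eq_sym x_neq0.
have xapos : 0 < x / a by rewrite divr_gt0.
rewrite -{1}(divfK (lt0r_neq0 a0) x) powRM ?(ltW xapos) ?(ltW a0)// mulrC.
rewrite ler_wpM2l ?powR_ge0// -ler_ln; first last.
- by rewrite posrE ltr_wpDl ?subr_ge0// mulr_gt0.
- by rewrite posrE powR_gt0.
have := concave_ln (Itv01 (ltW t0) t1) xapos (@ltr01 R).
by rewrite ln1 ln_powR !convRE/= mulr0 addr0 mulr1 /onem addrC.
Qed.

Lemma measurable_ratio f g : is_density mu f -> is_density mu g ->
  measurable_fun setT (fun y => f y / g y).
Proof.
move=> [mf _ _] [mg g0 _]; apply: measurable_funM => //.
under eq_fun do rewrite -powR_inv1//.
exact: (measurableT_comp (@measurable_powR R (-1))).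
Qed.

Lemma measurable_sqrt_ratio_powR f g theta : is_density mu f -> is_density mu g ->
  measurable_fun setT (fun y => Num.sqrt (g y / f y) `^ theta).
Proof.
move=> hf hg; apply: (measurableT_comp (@measurable_powR R theta)).
apply: (@measurableT_comp _ _ _ _ _ _ (@Num.sqrt R)); last exact: measurable_ratio.
by apply: continuous_measurable_fun; exact: sqrt_continuous.
Qed.

Section KullbackLeibler.
Variables f g : R -> R.
Hypotheses (hf : is_density mu f) (hg : is_density mu g).

Let mf : measurable_fun setT f. Proof. by case: hf. Qed.
Let mg : measurable_fun setT g. Proof. by case: hg. Qed.
Let f0 y : 0 <= f y. Proof. by case: hf. Qed.
Let g0 y : 0 <= g y. Proof. by case: hg. Qed.
Let f1 : (\int[mu]_y (f y)%:E = 1)%E. Proof. by case: hf. Qed.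
Let g1 : (\int[mu]_y (g y)%:E = 1)%E. Proof. by case: hg. Qed.

Lemma integrable_density h : is_density mu h ->
  mu.-integrable setT (fun y => (h y)%:E).
Proof.
case=> mh h0 h1; apply/integrableP; split; first exact/measurable_EFinP.
under eq_integral do rewrite gee0_abs ?lee_fin//.
by rewrite h1 ltry.
Qed.

Lemma measurable_sqrtM : measurable_fun setT (fun y => Num.sqrt (f y * g y)).
Proof.
apply: (@measurableT_comp _ _ _ _ _ _ (@Num.sqrt R)); last exact: measurable_funM.
apply: continuous_measurable_fun; exact: sqrt_continuous.
Qed.

Lemma mulr_sqrt_ratio y : f y * Num.sqrt (g y / f y) = Num.sqrt (f y * g y).
Proof.
have [->|fy] := eqVneq (f y) 0; first by rewrite !mul0r sqrtr0.
rewrite -{1}(ger0_norm (f0 y)) -sqrtr_sqr -sqrtrM ?sqr_ge0//; congr Num.sqrt.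
by field.
Qed.

(** This form has no quotient and shows the symmetry in [f] and [g]. *)
Lemma affinityE : affinity mu f g = (\int[mu]_y (Num.sqrt (f y * g y))%:E)%E.
Proof.
by apply: eq_integral => y _; rewrite -EFinM mulr_sqrt_ratio.
Qed.

Lemma sqrtM_le_mean y : Num.sqrt (f y * g y) <= (f y + g y) / 2.
Proof.
rewrite -[leRHS]ger0_norm ?divr_ge0 ?addr_ge0// -sqrtr_sqr ler_wsqrtr//.
have := sqr_ge0 (f y - g y); nra.
Qed.

Lemma integrable_sqrtM : mu.-integrable setT (fun y => (Num.sqrt (f y * g y))%:E).
Proof.
apply: (le_integrable measurableT _ _
  (integrableD measurableT (integrable_density hf) (integrable_density hg))).
  by apply/measurable_EFinP; exact: measurable_sqrtM.
move=> y _; rewrite /= lee_fin !ger0_norm ?sqrtr_ge0 ?addr_ge0//.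
apply: le_trans (sqrtM_le_mean y) _.
by rewrite ler_pdivrMr// ler_peMr ?addr_ge0// ler1n.
Qed.

Lemma affinity_fin_num : affinity mu f g \is a fin_num.
Proof.
by rewrite affinityE; apply: integrable_fin_num => //; exact: integrable_sqrtM.
Qed.

Lemma affinity_le1 : (affinity mu f g <= 1)%E.
Proof.
rewrite affinityE.
apply: (@le_trans _ _ (\int[mu]_y (2^-1%:E * ((f y)%:E + (g y)%:E)))%E).
  apply: le_integral => //; first exact: integrable_sqrtM.
    apply: integrableZl => //.
    by apply: integrableD => //; exact: integrable_density.
  by move=> y _; rewrite -EFinD -EFinM lee_fin [leRHS]mulrC sqrtM_le_mean.
rewrite integralZl//; last by apply: integrableD => //; exact: integrable_density.
rewrite integralD//; [|exact: integrable_density..].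
by rewrite f1 g1 -EFinD -EFinM lee_fin; lra.
Qed.

Let k y := ((f y)%:E * lne ((f y)%:E / (g y)%:E))%E.

Lemma KL_integrandE y : k y =
  if f y == 0 then 0%E else if g y == 0 then +oo%E else (f y * ln (f y / g y))%:E.
Proof.
rewrite /k; case: ifPn => [/eqP ->|fy]; first by rewrite mul0e.
have fpos : 0 < f y by rewrite lt_neqAle eq_sym fy f0.
rewrite inver; case: ifPn => gy; first by rewrite gt0_muley ?lte_fin//= gt0_muley ?lte_fin.
rewrite -EFinM lne_EFin ?EFinM// divr_gt0// lt_neqAle eq_sym gy g0//.
Qed.

Lemma measurable_eq0 (h : R -> R) : measurable_fun setT h ->
  measurable_fun setT (fun y => h y == 0).
Proof. by move=> mh; apply: measurable_fun_eqr. Qed.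

Lemma measurable_log_ratio : measurable_fun setT (fun y => ln (f y / g y)).
Proof.
by apply: (measurableT_comp (@measurable_ln R)); exact: measurable_ratio.
Qed.

Lemma measurable_KL_integrand : measurable_fun setT k.
Proof.
rewrite (_ : k = fun y => if f y == 0 then 0%E else
   if g y == 0 then +oo%E else (f y * ln (f y / g y))%:E); last first.
  by apply/funext => y; rewrite KL_integrandE.
apply: measurable_fun_ifT => //; first exact: measurable_eq0.
apply: measurable_fun_ifT => //; first exact: measurable_eq0.
by apply/measurable_EFinP; apply: measurable_funM => //; exact: measurable_log_ratio.
Qed.

(** This is [ln u <= u - 1] at [u = g y / f y]. The second alternative isolates the points where the
    extended log-ratio is [+oo] but the real quotient takes a default value. *)
Lemma sub_le_mul_ln_ratio y : f y - g y <= f y * ln (f y / g y) \/ g y = 0 /\ f y != 0.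
Proof.
have [fy|fy] := eqVneq (f y) 0; first by left; rewrite fy mul0r sub0r oppr_le0.
have [gy|gy] := eqVneq (g y) 0; [by right|left].
have fpos : 0 < f y by rewrite lt_neqAle eq_sym fy f0.
have gpos : 0 < g y by rewrite lt_neqAle eq_sym gy g0.
have gf : 0 < g y / f y by rewrite divr_gt0.
rewrite -[f y / g y]invf_div lnV ?posrE// mulrN lerNr opprB.
have := @le_ln1Dx R (g y / f y - 1); rewrite subrKC => /(_ _) h.
have {h} : ln (g y / f y) <= g y / f y - 1 by apply: h; rewrite ltrBrDr addNr.
by move=> /(ler_wpM2l (f0 y)); rewrite (_ : _ * (_ - 1) = g y - f y)//; field.
Qed.

Lemma funeneg_KL_le y : (k^\- y <= (g y)%:E)%E.
Proof.
rewrite funenegE ge_max lee_fin g0 andbT KL_integrandE.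
have := sub_le_mul_ln_ratio y.
case: ifPn => fy; first by rewrite oppe0 lee_fin.
case: ifPn => gy; first by rewrite leNye.
move=> [h|[g'0]]; last by rewrite g'0 eqxx in gy.
rewrite -EFinN lee_fin lerNl; apply: le_trans h.
by rewrite lerDr.
Qed.

Variable C : R.
Hypothesis hC : (KL mu f g <= C%:E)%E.

(** The negative part lies below [g], hence has a finite integral; the bound [C] on the divergence
    then forces the positive part to have one too. *)
Lemma integrable_KL_integrand : mu.-integrable setT k.
Proof.
have mk := measurable_KL_integrand.
apply/integrableP; split => //.
have kneg : (\int[mu]_y k^\- y < +oo)%E.
  apply: (@le_lt_trans _ _ (\int[mu]_y (g y)%:E)%E); last by rewrite g1 ltry.
  apply: ge0_le_integral => //.
  - exact: measurable_funeneg.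
  - exact/measurable_EFinP.
  - by move=> y _; exact: funeneg_KL_le.
have kpos : (\int[mu]_y k^\+ y < +oo)%E.
  move: hC; rewrite /KL /expect integralE -/k.
  case: (\int[mu]_y k^\+ y)%E => [r|//|//]; first by rewrite ltry.
  have : (0 <= \int[mu]_y k^\- y)%E by exact: integral_ge0.
  by move: kneg; case: (\int[mu]_y k^\- y)%E.
rewrite (eq_integral (k^\+ \+ k^\-)%E); last first.
  by move=> y _; rewrite -[LHS]/((abse \o k) y) fune_abse.
rewrite ge0_integralD//; first exact: lte_add_pinfty.
- exact: measurable_funepos.
- exact: measurable_funeneg.
Qed.

Lemma KL_fin_num : KL mu f g \is a fin_num.
Proof. exact: (integrable_fin_num measurableT integrable_KL_integrand). Qed.

(** An integrable function is finite almost everywhere, and [k] is infinite wherever [g] vanishes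
    and [f] does not. *)
Lemma ae_ratio_defined : {ae mu, forall y, g y = 0 -> f y = 0}.
Proof.
have := integrable_ae measurableT integrable_KL_integrand.
apply: filterS => y /(_ Logic.I); rewrite KL_integrandE => + gy.
by case: ifPn => [/eqP//|_]; rewrite gy eqxx.
Qed.

Lemma integral_density_zeros : (\int[mu]_y (f y * \1_[set z | f z = 0 \/ g z = 0] y)%:E = 0)%E.
Proof.
have mZ : measurable [set z | f z = 0 \/ g z = 0].
  rewrite (_ : [set z | _] = f @^-1` [set 0] `|` g @^-1` [set 0])//.
  apply: measurableU; rewrite -[X in measurable X]setTI.
    exact: mf.
  exact: mg.
rewrite (@ae_eq_integral _ _ _ mu setT (cst 0%E))//; first by rewrite integral0.
- by apply/measurable_EFinP; apply: measurable_funM => //; exact: measurable_indic.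
- apply: filterS ae_ratio_defined => y /= gf _; rewrite indicE.
  case: (boolP (_ \in _)) => [/set_mem[->|/gf ->]|_]; by rewrite ?mul0r ?mulr0.
Qed.

(** Passes from the extended log-ratio to the real one; they can differ only on the null set where
    [g] vanishes and [f] does not. *)
Lemma integrable_log_ratio :
  mu.-integrable setT (fun y => (f y * ln (f y / g y))%:E) /\
  (\int[mu]_y (f y * ln (f y / g y))%:E = KL mu f g)%E.
Proof.
have mphi : measurable_fun setT (fun y => (f y * ln (f y / g y))%:E).
  by apply/measurable_EFinP; apply: measurable_funM => //; exact: measurable_log_ratio.
have ae_k : ae_eq mu setT k (fun y => (f y * ln (f y / g y))%:E).
  apply: filterS ae_ratio_defined => y gf _; rewrite KL_integrandE.
  case: ifPn => [/eqP ->|fy]; first by rewrite mul0r.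
  by case: ifPn => // /eqP /gf fy0; rewrite fy0 eqxx in fy.
split; last by apply: ae_eq_integral => //; [exact: measurable_KL_integrand|
  apply: ae_eq_sym].
have /integrableP[mk ik] := integrable_KL_integrand.
apply/integrableP; split => //.
rewrite (@ae_eq_integral _ _ _ mu setT (abse \o k))//.
- exact: measurableT_comp.
- exact: measurableT_comp.
- by apply: filterS ae_k => y /(_ Logic.I) <-.
Qed.

(* Jensen's inequality for [expR], through the tangent at [- KL / 2]. *)
Lemma expR_KL_le_affinity :
  ((expR (- (fine (KL mu f g) / 2)))%:E <= affinity mu f g)%E.
Proof.
have [iphi phiE] := integrable_log_ratio.
set K := fine (KL mu f g); set t := - (K / 2).
have iF := integrable_density hf.
have ilin : mu.-integrable setT (fun y =>
    ((1 - t) * expR t)%:E * (f y)%:E + (- (expR t / 2))%:E * (f y * ln (f y / g y))%:E)%E.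
  by apply: integrableD => //; exact: integrableZl.
rewrite affinityE.
apply: (@le_trans _ _ (\int[mu]_y (((1 - t) * expR t)%:E * (f y)%:E +
    (- (expR t / 2))%:E * (f y * ln (f y / g y))%:E))%E).
  rewrite integralD//; [|exact: integrableZl..].
  rewrite !integralZl// f1 phiE -(fineK KL_fin_num) -!EFinM -EFinD lee_fin -/K.
  by rewrite /t; lra.
apply: ae_le_integral => //; first exact: integrable_sqrtM.
apply: filterS ae_ratio_defined => y gf.
rewrite -!EFinM -EFinD lee_fin.
have [fy|fy] := eqVneq (f y) 0; first by rewrite fy !(mul0r, mulr0) sqrtr0 addr0.
have gy : g y != 0 by apply: contra_neq fy.
have fpos : 0 < f y by rewrite lt_neqAle eq_sym fy f0.
have gpos : 0 < g y by rewrite lt_neqAle eq_sym gy g0.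
have gf0 : 0 < g y / f y by rewrite divr_gt0.
rewrite -mulr_sqrt_ratio.
rewrite -powR12_sqrt ?(ltW gf0)// /powR gt_eqF//.
set L := ln (f y / g y).
have -> : ln (g y / f y) = - L by rewrite /L -lnV ?posrE ?divr_gt0// invf_div.
rewrite (_ : 2^-1 * - L = - (L / 2) - t + t); last by ring.
rewrite expRD.
have := expR_ge1Dx (- (L / 2) - t).
move=> /(ler_wpM2r (expR_ge0 t)) /(ler_wpM2l (f0 y)).
apply: le_trans; rewrite le_eqVlt; apply/orP; left; apply/eqP; ring.
Qed.

Lemma affinity_gt0 : (0 < affinity mu f g)%E.
Proof. by apply: lt_le_trans expR_KL_le_affinity; rewrite lte_fin expR_gt0. Qed.

Lemma ln_affinity_bounds : 0 <= - 2 * ln (fine (affinity mu f g)) <= fine (KL mu f g).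
Proof.
have Apos : 0 < fine (affinity mu f g) by rewrite fine_gt0// affinity_gt0 ltey_eq affinity_fin_num.
apply/andP; split.
  rewrite mulNr oppr_ge0 pmulr_rle0// ln_le0// -lee_fin fineK ?affinity_fin_num//.
  exact: affinity_le1.
have := expR_KL_le_affinity.
rewrite -(fineK affinity_fin_num) lee_fin -{1}(lnK Apos) ler_expR.
lra.
Qed.

(** Jensen's inequality for the concave power [theta], obtained by integrating its tangent at the
    affinity, which is the mean of the square-rooted ratio under [f]. *)
Lemma integral_affinity_powR theta : 0 < theta <= 1 ->
  exists2 M, (\int[mu]_y (f y * Num.sqrt (g y / f y) `^ theta)%:E = M%:E)%E &
    M <= fine (affinity mu f g) `^ theta.
Proof.
move=> t01; set A := fine (affinity mu f g).
have Apos : 0 < A by rewrite fine_gt0// affinity_gt0 ltey_eq affinity_fin_num.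
have iF := integrable_density hf.
have iS := integrable_sqrtM.
have mS : measurable_fun setT (fun y => f y * Num.sqrt (g y / f y) `^ theta).
  by apply: measurable_funM => //; exact: measurable_sqrt_ratio_powR.
have ilin : mu.-integrable setT (fun y => (A `^ theta * (1 - theta))%:E * (f y)%:E +
     (A `^ theta * theta / A)%:E * (Num.sqrt (f y * g y))%:E)%E.
  by apply: integrableD => //; exact: integrableZl.
have : (\int[mu]_y (f y * Num.sqrt (g y / f y) `^ theta)%:E <= (A `^ theta)%:E)%E.
  apply: (@le_trans _ _ (\int[mu]_y ((A `^ theta * (1 - theta))%:E * (f y)%:E +
     (A `^ theta * theta / A)%:E * (Num.sqrt (f y * g y))%:E))%E).
    apply: ge0_le_integral => //.
    - by move=> y _; rewrite lee_fin mulr_ge0// powR_ge0.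
    - exact/measurable_EFinP.
    - exact: measurable_int ilin.
    - move=> y _; rewrite -!EFinM -EFinD lee_fin.
      have := powR_le_tangent Apos (sqrtr_ge0 (g y / f y)) t01.
      move=> /(ler_wpM2l (f0 y)) /le_trans; apply.
      rewrite le_eqVlt; apply/orP; left; apply/eqP.
      rewrite -mulr_sqrt_ratio; ring.
  rewrite integralD//; [|exact: integrableZl..].
  rewrite !integralZl// f1 -affinityE -(fineK affinity_fin_num) -/A -!EFinM -EFinD lee_fin.
  by rewrite mulfVK ?gt_eqF// mulr1 -mulrDr subrK mulr1.
have : (0 <= \int[mu]_y (f y * Num.sqrt (g y / f y) `^ theta)%:E)%E.
  by apply: integral_ge0 => y _; rewrite lee_fin mulr_ge0// powR_ge0.
case: (\int[mu]_y _)%E => // M _; rewrite lee_fin => MA.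
by exists M.
Qed.

End KullbackLeibler.
End Densities.

(** * Kraft's inequality for the discretized factors *)

Section Codes.
Context {R : realType}.

(** Level indices stand for the entries of the two factors, and [None] for a zero entry of the
    second. Distinct codes may describe the same pair of matrices. *)
Definition code n1 n2 r L : finType :=
  ({ffun 'I_n1 * 'I_r -> 'I_L} * {ffun 'I_r * 'I_n2 -> option 'I_L})%type.

Definition code_size n1 n2 r L (c : code n1 n2 r L) : nat :=
  (n1 * r + #|[pred e | c.2 e != None]|)%N.

(** The weight is a product over entries, so the sum factorizes: an entry of the first factor
    contributes [L * q], and an entry of the second [1 + L * q], where the 1 comes from [None]. *)
Lemma sum_code_weight n1 n2 r L (q : R) :
  \sum_(c : code n1 n2 r L) q ^+ code_size c =
  (L%:R * q) ^+ (n1 * r) * (1 + L%:R * q) ^+ (r * n2).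
Proof.
transitivity (\sum_(f : {ffun 'I_n1 * 'I_r -> 'I_L})
   \sum_(g : {ffun 'I_r * 'I_n2 -> option 'I_L})
   (\prod_(e : 'I_n1 * 'I_r) q) * (\prod_e (if g e is Some _ then q else 1))).
  rewrite pair_bigA /=; apply: eq_bigr => -[f g] _ /=.
  rewrite /code_size exprD prodr_const card_prod !card_ord; congr (_ * _).
  rewrite (eq_bigr (fun e => if g e != None then q else 1)); last by move=> e _; case: (g e).
  by rewrite -big_mkcond/= prodr_const; congr (_ ^+ _); apply: eq_card.
under eq_bigr do rewrite -big_distrr/=.
rewrite -big_distrl/=; congr (_ * _).
  rewrite sumr_const card_ffun card_prod !card_ord prodr_const card_prod !card_ord.
  by rewrite exprMn -natrX mulr_natl.
rewrite -(bigA_distr_bigA (fun _ (o : option 'I_L) => if o is Some _ then q else 1)).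
rewrite prodr_const card_prod !card_ord; congr (_ ^+ _).
rewrite (bigD1 None)//= (eq_bigr (fun=> q)); last by case.
by rewrite sumr_const cardC1 card_option card_ord mulr_natl.
Qed.

(** Here [x] stands for the number of levels times the weight per entry. For [N >= 3],
    [N * x <= 2 / 3], so Bernoulli's inequality for [(1 - x) ^+ N] bounds [(1 + x) ^+ N] by 3, while
    [x ^+ n1 <= x <= 1 / 3]. *)
Lemma kraft_base (x : R) n1 n2 : 0 <= x -> x * (maxn n1 n2)%:R ^+ 2 <= 2 -> (4 <= n1 * n2)%N ->
  x ^+ n1 * (1 + x) ^+ n2 <= 1.
Proof.
set N := maxn n1 n2 => x0 xN n4.
have n1_gt0 : (0 < n1)%N by case: n1 n4 {xN N}.
have n1N : (n1 <= N)%N by exact: leq_maxl.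
have n2N : (n2 <= N)%N by exact: leq_maxr.
have [N3|N2] := leqP 3 N; last first.
  (* The remaining case is the 2 by 2 one, where [x <= 1 / 2] and so [x * (1 + x) <= 3 / 4]. *)
  have NE : N = 2%N.
    apply/eqP; rewrite eqn_leq -ltnS N2/= ltnNge; apply/negP => N1.
    by move: n4; rewrite leqNgt ltnS (leq_trans (leq_mul (leq_trans n1N N1) (leq_trans n2N N1))).
  have [-> ->] : n1 = 2%N /\ n2 = 2%N.
    move: n1N n2N n4; rewrite NE.
    by case: (n1) => [|[|[|?]]]//; case: (n2) => [|[|[|?]]].
  move: xN; rewrite NE => xN; nra.
have N3R : 3 <= N%:R :> R by rewrite (ler_nat R 3 N).
have xN' : x * N%:R <= 2 / 3 by nra.
have x1 : x <= 1 by nra.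
have h1 : (1 + x) ^+ n2 <= (1 + x) ^+ N by rewrite ler_weXn2l// lerDl.
have bern k : 1 - k%:R * x <= (1 - x) ^+ k.
  elim: k => [|k IH]; first by rewrite mul0r subr0.
  rewrite exprS; apply: (@le_trans _ _ ((1 - x) * (1 - k%:R * x))).
    rewrite -natr1; have := ler0n R k; nra.
  by rewrite ler_wpM2l// subr_ge0.
have h2 : (1 + x) ^+ N * (1 - x) ^+ N <= 1.
  rewrite -exprMn exprn_ile1//; nra.
have h3 : (1 + x) ^+ N <= 3.
  have := bern N; have : 1 <= (1 + x) ^+ N by rewrite exprn_ege1// lerDl.
  nra.
have h4 : x ^+ n1 <= x by rewrite -[leRHS]expr1 ler_wiXn2l.
have : 0 <= (1 + x) ^+ n2 by rewrite exprn_ge0// addr_ge0.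
have := exprn_ge0 n1 x0.
have : x * 3 <= 1 by nra.
nra.
Qed.

(** Rounding the binary logarithm up adds less than 1 to the exponent. *)
Lemma Llev_le n1 n2 (beta : R) : (0 < maxn n1 n2)%N -> 0 <= beta ->
  (Llev n1 n2 beta)%:R <= 2 * (maxn n1 n2)%:R `^ beta.
Proof.
rewrite /Llev; set N := maxn n1 n2 => N0 b0.
have NR : 1 <= N%:R :> R by rewrite (ler_nat R 1).
have N0R : 0 < N%:R :> R by rewrite ltr0n.
have ln2 : 0 < ln (2 : R) by rewrite ln_gt0// (ltr_nat R 1).
set z := ln _ / ln 2.
have z0 : 0 <= z by rewrite divr_ge0 ?(ltW ln2)// ln_powR mulr_ge0// ln_ge0.
rewrite natrX -powR_mulrn// natr_absz ger0_norm ?ceil_ge0; last exact: (lt_le_trans _ z0).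
have -> : 2 * N%:R `^ beta = 2 `^ (z + 1).
  rewrite powRD; last by apply/implyP => _.
  rewrite powRr1// mulrC; congr (_ * _).
  by rewrite /powR !gt_eqF// /z divfK ?gt_eqF// ln_powR.
rewrite ler_powR ?(ler_nat R 1)//.
by have := ceilB1_lt z; rewrite rmorphB/= ltrBlDr => /ltW.
Qed.

Lemma factors_decode n1 n2 r L (a b : R) (GD GA : set R) :
  uniform_levels L a GD -> uniform_levels L b GA ->
  exists decode : code n1 n2 r L -> 'M[R]_(n1, r) * 'M[R]_(r, n2),
  forall DA, factors GD GA DA ->
  exists2 c, decode c = DA & code_size c = (n1 * r + nnz DA.2)%N.
Proof.
move=> [aD [hD [_ GDE _]]] [aA [hA [_ GAE _]]].
pose dec (c : code n1 n2 r L) : 'M[R]_(n1, r) * 'M[R]_(r, n2) :=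
  (\matrix_(i, j) (aD + (c.1 (i, j))%:R * hD),
   \matrix_(i, j) (if c.2 (i, j) is Some k then aA + k%:R * hA else 0)).
exists dec => -[D A] [/= hGD hGA].
have /choice[f fP] : forall e : 'I_n1 * 'I_r, exists k : 'I_L,
    D e.1 e.2 = aD + k%:R * hD.
  move=> [i j]; have := hGD i j; rewrite GDE => -[k kL <-].
  by exists (Ordinal kL).
have /choice[g gP] : forall e : 'I_r * 'I_n2, exists o : option 'I_L,
    A e.1 e.2 = (if o is Some k then aA + k%:R * hA else 0) /\
    (o == None) = (A e.1 e.2 == 0).
  (* A zero entry is always coded by [None], even if 0 is one of the levels, so that the code size
     counts exactly the nonzero entries. *)
  move=> [i j] /=; have [Aij|Aij] := eqVneq (A i j) 0; first by exists None.
  have [A0|] := hGA i j; first by rewrite A0 eqxx in Aij.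
  by rewrite GAE => -[k kL <-]; exists (Some (Ordinal kL)).
exists (finfun f, finfun g).
  congr pair; apply/matrixP => i j; rewrite mxE ffunE.
    by rewrite -fP.
  by have [] := gP (i, j).
rewrite /code_size /nnz; congr (_ + _)%N; apply: eq_card => e /=.
have [_ ge] := gP e.
rewrite [LHS]inE/= ffunE ge.
by apply/idP/idP => [h|/set_mem//]; exact: mem_set.
Qed.

(** Kraft's inequality: the sum is the [r]-th power of the quantity in [kraft_base]. Its condition
    holds because there are at most [2 * N ^ beta] levels and each weight is
    [N ^ (- (beta + 2))]. *)
Lemma sum_code_weight_le1 n1 n2 r (beta : R) : 0 <= beta -> (4 <= n1 * n2)%N ->
  \sum_(c : code n1 n2 r (Llev n1 n2 beta))
    (maxn n1 n2)%:R `^ (- (beta + 2)) ^+ code_size c <= 1.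
Proof.
move=> b0 n4; rewrite sum_code_weight exprM [(r * n2)%N]mulnC exprM -exprMn.
have N0 : (0 < maxn n1 n2)%N.
  by rewrite leq_max; case: n1 n4.
apply: exprn_ile1; first by rewrite mulr_ge0 ?exprn_ge0 ?addr_ge0 ?mulr_ge0 ?powR_ge0.
apply: kraft_base => //.
have := Llev_le N0 b0; set L := (Llev _ _ _)%:R; set N := (maxn n1 n2)%:R.
have N0R : 0 < N :> R by rewrite ltr0n.
move=> LN; rewrite powRN powRD; last by apply/implyP => _; rewrite gt_eqF.
rewrite powR_mulrn ?(ltW N0R)//.
rewrite (_ : _ * _ = L / N `^ beta).
  by rewrite ler_pdivrMr// powR_gt0.
by field; rewrite !gt_eqF ?powR_gt0.
Qed.

End Codes.

(** * The tilted likelihood ratio *)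

Lemma ln_prod {R : realType} (I : finType) (Q : pred I) (F : I -> R) :
  (forall i, Q i -> 0 < F i) -> ln (\prod_(i | Q i) F i) = \sum_(i | Q i) ln (F i).
Proof.
move=> F0; pose K (x y : R) := 0 < x /\ ln x = y.
suff [] : K (\prod_(i | Q i) F i) (\sum_(i | Q i) ln (F i)) by [].
apply: (big_ind2 K) => [|x1 y1 x2 y2 [x10 <-] [x20 <-]|i Qi].
- by split; rewrite ?ln1.
- by split; rewrite ?mulr_gt0// lnM.
- by split; rewrite ?F0.
Qed.

Section LikelihoodRatio.
Context {R : realType} {d : measure_display} {T : measurableType d}.
Variables (P : probability T R) (n1 n2 : nat).
Notation E := ('I_n1 * 'I_n2)%type.
Variables (mu : {measure set R -> \bar R}) (p : R -> R -> R).
Hypothesis hp : forall x, is_density mu (p x).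
Variables (Xstar : 'M[R]_(n1, n2)) (S : T -> {set E}).
Variable Y : 'I_n1 -> 'I_n2 -> {RV P >-> R}.
Variable gamma : R.
Hypothesis mS : forall i, measurable [set w | i \in S w].
Hypothesis hP : forall i, P [set w | i \in S w] = gamma%:E.
Hypothesis hI : independent_events P (fun i => [set w | i \in S w]).
Hypothesis hY : conditional_density mu p Xstar S Y.
Variable CD : R.
Implicit Types X : 'M[R]_(n1, n2).

Local Notation pdf X e := (p (fun_of_matrix X e.1 e.2)).
Local Notation obs e w := (Y e.1 e.2 w).

Let p0 x y : 0 <= p x y. Proof. by have [_] := hp x. Qed.
Let mp x : measurable_fun setT (p x). Proof. by have [] := hp x. Qed.

Definition affinity_entry X e := fine (affinity mu (pdf Xstar e) (pdf X e)).

Definition KL_entry X e := fine (KL mu (pdf Xstar e) (pdf X e)).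

Definition log_affinity X := \sum_e ln (affinity_entry X e).

(** The sum runs over all entries, with an indicator instead of the random index set, so that it can
    be integrated term by term. *)
Definition log_ratio X w :=
  \sum_e \1_[set w | e \in S w] w * ln (pdf Xstar e (obs e w) / pdf X e (obs e w)).

(* A fractional power of the square-rooted likelihood ratio, normalized so that
   its mean is at most 1. *)
Definition tilt theta X w :=
  (\prod_(e in S w) Num.sqrt (pdf X e (obs e w) / pdf Xstar e (obs e w)) `^ theta)
  * expR (- (theta / 3 * gamma * log_affinity X)).

(** * Moment bounds for a fixed candidate *)

Section Candidate.
Variable X : 'M[R]_(n1, n2).
Hypothesis hCD : forall e, (KL mu (pdf Xstar e) (pdf X e) <= CD%:E)%E.

Lemma integral_log_ratio :
  P.-integrable setT (fun w => (log_ratio X w)%:E) /\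
  (\int[P]_w (log_ratio X w)%:E = (gamma * \sum_e KL_entry X e)%:E)%E.
Proof.
have H e := integrable_log_ratio (hp (Xstar e.1 e.2)) (hp (X e.1 e.2)) (hCD e).
have H' e := integral_observed hp mS hY hP hI
  (measurable_log_ratio (hp (Xstar e.1 e.2)) (hp (X e.1 e.2))) (H e).1.
have sE : (fun w => (log_ratio X w)%:E) = (fun w => \sum_e (\1_[set w | e \in S w] w *
    ln (pdf Xstar e (obs e w) / pdf X e (obs e w)))%:E)%E.
  by apply/funext => w; rewrite sumEFin.
rewrite sE; split.
  by apply: integrable_sum => // e _; have [] := H' e.
rewrite integral_sum//; last by move=> e; have [] := H' e.
rewrite mulr_sumr -sumEFin; apply: eq_bigr => e _.
have [_ ->] := H' e; rewrite (H e).2 EFinM fineK//.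
exact: (KL_fin_num (hp _) (hp _) (hCD e)).
Qed.

(** Finite divergence makes the zeros of either density negligible for the law of each observed
    entry. Logarithms of likelihoods are then genuine almost surely. *)
Lemma ae_likelihood_gt0 : {ae P, forall w e, e \in S w ->
  0 < pdf Xstar e (obs e w) /\ 0 < pdf X e (obs e w)}.
Proof.
have : forall e, {ae P, forall w, e \in S w ->
    ~ (pdf Xstar e (obs e w) = 0 \/ pdf X e (obs e w) = 0)}.
  move=> e; apply: (ae_observed (N := [set z | pdf Xstar e z = 0 \/ pdf X e z = 0]) hp mS hY hP hI).
    rewrite (_ : [set z | _] = pdf Xstar e @^-1` [set 0] `|` pdf X e @^-1` [set 0])//.
    by apply: measurableU; rewrite -[X in measurable X]setTI; exact: mp.
  exact: (integral_density_zeros (hp (Xstar e.1 e.2)) (hp (X e.1 e.2)) (hCD e)).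
move=> /filter_forall; apply: filterS => w h e eS.
have /not_orP[/eqP h1 /eqP h2] := h e eS.
by rewrite !lt_neqAle !p0 eq_sym h1 eq_sym h2.
Qed.

Lemma ln_tilt theta w :
  (forall e, e \in S w -> 0 < pdf Xstar e (obs e w) /\ 0 < pdf X e (obs e w)) ->
  0 < tilt theta X w /\
  ln (tilt theta X w) = - (theta / 2 * log_ratio X w) - theta / 3 * gamma * log_affinity X.
Proof.
move=> pos.
have pos' e : e \in S w ->
    0 < Num.sqrt (pdf X e (obs e w) / pdf Xstar e (obs e w)) `^ theta.
  by move=> /pos[? ?]; rewrite powR_gt0// sqrtr_gt0 divr_gt0.
have prod_pos : 0 < \prod_(e in S w)
    Num.sqrt (pdf X e (obs e w) / pdf Xstar e (obs e w)) `^ theta.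
  exact: prodr_gt0.
split; first by rewrite mulr_gt0// expR_gt0.
rewrite lnM ?posrE ?expR_gt0// expRK; congr (_ + _).
rewrite ln_prod// /log_ratio mulr_sumr -sumrN [LHS]big_mkcond/=.
apply: eq_bigr => e _; rewrite indicE.
have [eS|eS] := boolP (e \in S w); last first.
  by rewrite memNset ?mul0r ?mulr0 ?oppr0//=; exact/negP.
have [s0 x0] := pos e eS.
rewrite mem_set// mul1r ln_powR -powR12_sqrt ?(ltW (divr_gt0 x0 s0))// ln_powR.
by rewrite !ln_div ?posrE//; field.
Qed.

Lemma ln_affinity_entry_bounds e : 0 <= - ln (affinity_entry X e) <= CD / 2.
Proof.
have := ln_affinity_bounds (hp (Xstar e.1 e.2)) (hp (X e.1 e.2)) (hCD e).
have := hCD e; rewrite -(fineK (KL_fin_num (hp (Xstar e.1 e.2)) (hp (X e.1 e.2)) (hCD e))) lee_fin.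
rewrite /affinity_entry => h1 /andP[h2 h3]; apply/andP; split; lra.
Qed.

Lemma affinity_entry_gt0 e : 0 < affinity_entry X e.
Proof.
have := affinity_gt0 (hp (Xstar e.1 e.2)) (hp (X e.1 e.2)) (hCD e).
by rewrite -(fineK (affinity_fin_num (hp _) (hp _))) lte_fin.
Qed.

(** The arguments come in the opposite order to [affinity_entry]; symmetry of the affinity
    reconciles the two. *)
Lemma lne_affinity_mx : ((- 2)%:E * lne (affinity_mx mu p X Xstar) =
  (- 2 * log_affinity X)%:E)%E.
Proof.
have -> : affinity_mx mu p X Xstar = (\prod_e affinity_entry X e)%:E.
  rewrite /affinity_mx (pair_bigA _ (fun i j => affinity mu (p (X i j)) (p (Xstar i j)))).
  rewrite -prodEFin; apply: eq_bigr => -[i j] _ /=.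
  rewrite /affinity_entry fineK; last exact: (affinity_fin_num (hp _) (hp _)).
  rewrite /= (affinityE _ (hp _)) (affinityE _ (hp _)).
  by apply: eq_integral => y _; rewrite mulrC.
rewrite lne_EFin ?ln_prod// => *; first exact: affinity_entry_gt0.
by apply: prodr_gt0 => e _; exact: affinity_entry_gt0.
Qed.

Lemma KL_mxE : KL_mx mu p Xstar X = (\sum_e KL_entry X e)%:E.
Proof.
rewrite /KL_mx (pair_bigA _ (fun i j => KL mu (p (Xstar i j)) (p (X i j)))).
rewrite -sumEFin; apply: eq_bigr => -[i j] _ /=.
by rewrite fineK//; exact: (KL_fin_num (hp _) (hp _) (hCD (i, j))).
Qed.

Lemma measurable_tilt_prod theta : measurable_fun setT (fun w =>
  \prod_(e in S w) Num.sqrt (pdf X e (obs e w) / pdf Xstar e (obs e w)) `^ theta).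
Proof.
rewrite (_ : (fun w => \prod_(e in S w) _) = (fun w => \prod_(e : E)
  ((\1_[set w | e \in S w] w) * (Num.sqrt (pdf X e (obs e w) / pdf Xstar e (obs e w)) `^ theta)
   + \1_(~` [set w | e \in S w]) w))); last first.
  apply/funext => w; rewrite big_mkcond/=; apply: eq_bigr => e _.
  rewrite !indicE in_setC; case: ifPn => eS; first by rewrite mem_set// mul1r addr0.
  by rewrite memNset ?mul0r ?add0r//=; exact/negP.
apply: measurable_prod_cond => e; apply: measurable_funD; last first.
  by apply: measurable_indic; exact: measurableC.
apply: measurable_funM; first exact: measurable_indic.
exact: (measurableT_comp (measurable_sqrt_ratio_powR theta (hp (Xstar e.1 e.2)) (hp (X e.1 e.2)))).
Qed.

Lemma measurable_tilt theta : measurable_fun setT (tilt theta X).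
Proof. by apply: measurable_funM => //; exact: measurable_tilt_prod. Qed.

Lemma tilt_ge0 theta w : 0 <= tilt theta X w.
Proof. by rewrite mulr_ge0 ?expR_ge0// prodr_ge0// => e _; exact: powR_ge0. Qed.

(** The mean factorizes over entries. With [x = - theta * ln A_e], one factor needs [1 + gamma *
    (expR (- x) - 1) <= expR (- gamma * x / 3)], which follows from [1 + u <= expR u] and
    [expR (- x) <= 1 - x / 3]. *)
Lemma integral_tilt_le1 : 0 <= CD -> gamma <= 1 ->
  (\int[P]_w (tilt (1 + 2 * CD / 3)^-1 X w)%:E <= 1)%E.
Proof.
move=> CD0 gamma1; set theta := (1 + 2 * CD / 3)^-1.
have D1 : 1 <= 1 + 2 * CD / 3 by rewrite lerDl divr_ge0// mulr_ge0.
have theta01 : 0 < theta <= 1.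
  by rewrite invr_gt0 invf_le1 ?D1 ?andbT//; apply: lt_le_trans D1.
have [theta0 theta1] := andP theta01.
have aff0 := affinity_entry_gt0.
have /choice[M MP] : forall e, exists M,
    (\int[mu]_y (pdf Xstar e y * Num.sqrt (pdf X e y / pdf Xstar e y) `^ theta)%:E = M%:E)%E /\
    M <= affinity_entry X e `^ theta.
  move=> e; have [M M1 M2] := integral_affinity_powR
    (hp (Xstar e.1 e.2)) (hp (X e.1 e.2)) (hCD e) theta01.
  by exists M.
have M0 e : 0 <= M e.
  rewrite -lee_fin -(MP e).1 integral_ge0// => y _.
  by rewrite lee_fin; apply: mulr_ge0; [exact: p0|exact: powR_ge0].
have mH e : measurable_fun setT (fun y => Num.sqrt (pdf X e y / pdf Xstar e y) `^ theta).
  exact: (measurable_sqrt_ratio_powR _ (hp _) (hp _)).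
have H0 e y : 0 <= Num.sqrt (pdf X e y / pdf Xstar e y) `^ theta by exact: powR_ge0.
have := integral_likelihood_sample hp mS hY mH H0 (fun e => (MP e).1).
rewrite (integral_sample_prod mS M hP hI) => prodE.
under eq_integral do rewrite EFinM muleC.
rewrite ge0_integralZl ?lee_fin ?expR_ge0//; last 2 first.
- by apply/measurable_EFinP; exact: measurable_tilt_prod.
- by move=> w _; rewrite lee_fin prodr_ge0.
rewrite prodE -EFinM lee_fin expRN mulrC ler_pdivrMr ?expR_gt0// mul1r.
rewrite /log_affinity mulr_sumr expR_sum.
apply: ler_prod => e _.
have /andP[a0 aCD] := ln_affinity_entry_bounds e.
have gamma0 : 0 <= gamma by rewrite -lee_fin -(hP e) measure_ge0.
have g1 : 0 <= 1 + gamma * (M e - 1).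
  by rewrite mulrBr mulr1 addrCA addr_ge0 ?mulr_ge0// subr_ge0.
rewrite g1/=; apply: le_trans (expR_ge1Dx _) _; rewrite ler_expR.
rewrite [leRHS](_ : _ = gamma * (theta / 3 * ln (affinity_entry X e))); last by ring.
rewrite ler_wpM2l//.
have [_ Mle] := MP e.
have : M e <= expR (theta * ln (affinity_entry X e)).
  by move: Mle; rewrite /powR gt_eqF.
(* The value of [theta] enters here: [CD / 2 <= 3 / 4 * (1 + 2 * CD / 3)]. *)
have t34 : theta * (- ln (affinity_entry X e)) <= 3 / 4.
  apply: (@le_trans _ _ (theta * (CD / 2))); first by rewrite ler_wpM2l// ltW.
  rewrite /theta mulrC ler_pdivrMr; last exact: lt_le_trans D1.
  lra.
have t0 : 0 <= theta * (- ln (affinity_entry X e)) by rewrite mulr_ge0// ltW.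
set x := theta * - _ in t34 t0.
have -> : theta * ln (affinity_entry X e) = - x by rewrite /x mulrN opprK.
have -> : theta / 3 * ln (affinity_entry X e) = - x / 3 by rewrite /x; field.
move=> Mx.
(* [expR (- x) <= 1 / (1 + x)], and [x <= 3 / 4] makes the slope at least 1/3. *)
have : expR (- x) * (1 + x) <= 1.
  by rewrite -[leRHS](expRxMexpNx_1 x) mulrC ler_wpM2r ?expR_ge0// expR_ge1Dx.
nra.
Qed.

End Candidate.
End LikelihoodRatio.

(** * The oracle inequality *)

(** The pointwise arithmetic of the oracle inequality: [t] is [2 / theta], [u] the code cost per
    entry scaled by [t], and [k1 + kh], [k1 + kd] are the code sizes of the estimator and of the
    competitor. [s0], [l2], [l3] are the log-likelihoods of the truth, the estimator and the
    competitor, and [z] is the weighted sum of tilts. *)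
Lemma combine_bounds {R : realFieldType}
    (lambda t u k1 kh kd l s0 l2 l3 g a z : R) :
  0 <= (lambda - u) * (k1 + kh) ->
  - u * (k1 + kh) - l - 2 / 3 * g * a <= t * (z - 1) ->
  l = s0 - l2 -> - l2 + lambda * kh <= - l3 + lambda * kd ->
  g / 3 * (- 2 * a) <= s0 - l3 + (lambda * (k1 + kd) - t) + t * z.
Proof. lra. Qed.

Theorem mainTheorem1
  (R : realType)
  (mu : {measure set R -> \bar R}) (p : R -> R -> R)
  (hp : forall x, is_density mu (p x))
  (n1 n2 r : nat) (hr : (r <= n2)%N)
  (Amax Xmax : R) (hA0 : 0 < Amax) (hA : Amax <= (maxn n1 n2)%:R)
  (hXmax : 1 <= Xmax)
  (Dstar : 'M[R]_(n1, r)) (Astar : 'M[R]_(r, n2)) (Xstar : 'M[R]_(n1, n2))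
  (hXstar : Xstar = Dstar *m Astar)
  (hDn : mx_norm Dstar <= 1) (hAn : mx_norm Astar <= Amax)
  (hXn : mx_norm Xstar <= Xmax / 2)
  (m : nat) (hm4 : (4 <= m)%N) (hm : (m <= n1 * n2)%N)
  (d : measure_display) (T : measurableType d) (P : probability T R)
  (S : T -> {set 'I_n1 * 'I_n2})
  (hS : bernoulli_sampling P (m%:R / (n1 * n2)%:R) S)
  (Y : 'I_n1 -> 'I_n2 -> {RV P >-> R})
  (hY : conditional_density mu p Xstar S Y)
  (beta : R) (hbeta : 1 <= beta)
  (GD GA : set R)
  (hGD : uniform_levels (Llev n1 n2 beta) 1 GD)
  (hGA : uniform_levels (Llev n1 n2 beta) Amax GA)
  (Xs : set 'M[R]_(n1, n2))
  (hXs : Xs `<=` @candidates R n1 n2 r GD GA Xmax)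
  (CD : R)
  (hCD : forall X, Xs X ->
     forall i j, (KL mu (p (Xstar i j)) (p (X i j)) <= CD%:E)%E)
  (lambda : R)
  (hlambda : 2 * (beta + 2) * (1 + 2 * CD / 3) * ln (maxn n1 n2)%:R <= lambda)
  (DAhat : T -> 'M[R]_(n1, r) * 'M[R]_(r, n2))
  (hmeas : forall DA, measurable [set w | DAhat w = DA])
  (hargmin : forall w,
     argmin_on (feasible GD GA Xs)
       (objective p lambda (S w) (fun i j => Y i j w)) (DAhat w)) :
  (((n1 * n2)%:R^-1)%:E *
     \int[P]_w ((- 2)%:E *
        lne (affinity_mx mu p ((DAhat w).1 *m (DAhat w).2) Xstar))
   <= (8 * CD * ln m%:R / m%:R)%:E
      + 3%:E * ereal_inf
          [set ((n1 * n2)%:R^-1)%:E * KL_mx mu p Xstar (DA.1 *m DA.2)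
               + ((lambda + 4 * CD * (beta + 2) * ln (maxn n1 n2)%:R / 3)
                  * ((n1 * r + @nnz R r n2 DA.2)%:R / m%:R))%:E
          | DA in @feasible R n1 n2 r GD GA Xs])%E.
Proof.
have [mS hP hI] := hS.
have n4 : (4 <= n1 * n2)%N := leq_trans hm4 hm.
have nn0 : 0 < (n1 * n2)%:R :> R by rewrite ltr0n; exact: leq_trans n4.
have m0 : 0 < m%:R :> R by rewrite ltr0n; exact: leq_trans hm4.
set gamma : R := m%:R / (n1 * n2)%:R in hP.
have gamma0 : 0 < gamma by rewrite divr_gt0.
have gamma1 : gamma <= 1 by rewrite ler_pdivrMr// mul1r ler_nat.
have n1_gt0 : (0 < n1)%N by case: (n1) n4.
have n2_gt0 : (0 < n2)%N by case: (n2) n4; rewrite ?muln0.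
have N1 : 1 <= (maxn n1 n2)%:R :> R by rewrite (ler_nat R 1) leq_max n1_gt0.
have lnN0 : 0 <= ln (maxn n1 n2)%:R :> R by exact: ln_ge0.
have beta0 : 0 <= beta by exact: le_trans hbeta.
(* A sample point yields a feasible pair, hence a default code and, through
   [0 <= - ln A_e <= CD / 2], the sign of [CD]. *)
have [w0 _] : exists w : T, True.
  apply: contrapT => h; have := probability_setT P.
  rewrite (_ : setT = set0) ?measure0; first by move=> /eqP; rewrite eq_sym onee_eq0.
  by apply/seteqP; split => // w _; apply: h; exists w.
have KLle (DA : 'M[R]_(n1, r) * 'M[R]_(r, n2)) : feasible GD GA Xs DA -> forall e : 'I_n1 * 'I_n2,
    (KL mu (p (Xstar e.1 e.2)) (p ((DA.1 *m DA.2) e.1 e.2)) <= CD%:E)%E.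
  by move=> [_ XDA] e; exact: hCD.
have hatF w : feasible GD GA Xs (DAhat w) by have [] := hargmin w.
have CD0 : 0 <= CD.
  have /andP[a0 aCD] := ln_affinity_entry_bounds hp (KLle _ (hatF w0))
    (Ordinal n1_gt0, Ordinal n2_gt0).
  by have := le_trans a0 aCD; rewrite pmulr_lge0.
have [dec decP] := @factors_decode R n1 n2 r _ _ _ GD GA hGD hGA.
have [c0 _ _] := decP _ (hatF w0).1.
(* [kappa] selects one code of the right size for each pair of factors. *)
have /choice[kappa kappaP] : forall DA, exists c, factors GD GA DA ->
    dec c = DA /\ code_size c = (n1 * r + nnz DA.2)%N.
  move=> DA; have [/decP[c c1 c2]|nF] := pselect (factors GD GA DA).
    by exists c.
  by exists c0.
pose feasb c := `[< feasible GD GA Xs (dec c) >].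
pose q : R := (maxn n1 n2)%:R `^ (- (beta + 2)).
have q0 : 0 <= q by exact: powR_ge0.
have kraft := @sum_code_weight_le1 R n1 n2 r beta beta0 n4.
pose theta := (1 + 2 * CD / 3)^-1.
have D1 : 1 <= 1 + 2 * CD / 3 by rewrite lerDl divr_ge0// mulr_ge0.
have theta0 : 0 < theta by rewrite invr_gt0 (lt_le_trans _ D1).
(* Infeasible codes get 0, since the divergence bound covers only candidates in [Xs]. *)
pose F c w := if feasb c then
  tilt mu p Xstar S Y gamma theta ((dec c).1 *m (dec c).2) w else 0.
pose Z w := \sum_c q ^+ code_size c * F c w.
pose G (DA : 'M[R]_(n1, r) * 'M[R]_(r, n2)) : R :=
  - 2 * log_affinity mu p Xstar (DA.1 *m DA.2).
have F0 c w : 0 <= F c w by rewrite /F; case: ifP => // _; exact: tilt_ge0.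
have intF c : (\int[P]_w (F c w)%:E <= 1)%E.
  have [fc|nfc] := asboolP (feasible GD GA Xs (dec c)); rewrite /F /feasb; last first.
    by rewrite asboolF// integral0.
  rewrite asboolT//.
  exact: (integral_tilt_le1 hp mS hP hI hY (KLle _ fc)).
have iF c : P.-integrable setT (fun w => (F c w)%:E).
  apply/integrableP; split.
    apply/measurable_EFinP; rewrite /F; case: (feasb c) => //.
    exact: measurable_tilt.
  under eq_integral do rewrite gee0_abs ?lee_fin//.
  exact: le_lt_trans (intF c) (ltry _).
have [iZ intZ] : P.-integrable setT (fun w => (Z w)%:E) /\ (\int[P]_w (Z w)%:E <= 1)%E.
  have ZE : (fun w => (Z w)%:E) =
      (fun w => \sum_c (q ^+ code_size c)%:E * (F c w)%:E)%E.
    by apply/funext => w; rewrite -sumEFin.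
  have iqF c : P.-integrable setT (fun w => (q ^+ code_size c)%:E * (F c w)%:E)%E.
    by apply: integrableZl => //; exact: iF.
  rewrite ZE; split; first by apply: integrable_sum => // c _; exact: iqF.
  rewrite integral_sum//.
  apply: (@le_trans _ _ (\sum_c (q ^+ code_size c)%:E)%E).
    apply: lee_sum => c _; rewrite integralZl//.
    by rewrite -[leRHS]mule1 lee_wpmul2l ?intF// lee_fin exprn_ge0.
  by rewrite sumEFin lee_fin.
have iG : P.-integrable setT (fun w => (G (DAhat w))%:E).
  (* The estimator takes finitely many values, so its loss is a finite combination of indicators.
     The factor [kappa (dec c) == c] keeps a single code for each value. *)
  have GE : (fun w => (G (DAhat w))%:E) = (fun w => \sum_c
      ((kappa (dec c) == c)%:R * G (dec c))%:E * (\1_[set w | DAhat w = dec c] w)%:E)%E.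
    apply/funext => w; under eq_bigr do rewrite -EFinM.
    rewrite sumEFin; congr EFin.
    have [dk _] := kappaP _ (hatF w).1.
    rewrite (bigD1 (kappa (DAhat w)))//= dk eqxx mul1r indicE mem_set// mulr1.
    rewrite big1 ?addr0// => c ck; rewrite indicE.
    have [/set_mem/= dc|_] := boolP (w \in _); last by rewrite mulr0.
    by rewrite -dc eq_sym (negbTE ck) !mul0r.
  rewrite GE; apply: integrable_sum => // c _.
  apply: integrableZl => //; apply: integrable_indic => //.
have key (DA : 'M[R]_(n1, r) * 'M[R]_(r, n2)) : feasible GD GA Xs DA ->
    ((gamma / 3)%:E * \int[P]_w (G (DAhat w))%:E <=
     (gamma * \sum_e KL_entry mu p Xstar (DA.1 *m DA.2) e
      + lambda * (n1 * r + nnz DA.2)%:R)%:E)%E.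
  move=> fDA.
  have [iL intL] := integral_log_ratio hp mS hP hI hY (KLle _ fDA).
  set sz := (n1 * r + nnz DA.2)%N.
  (* The term [- 2 / theta] comes from [ln t <= t - 1]; after integration it absorbs [2 / theta]
     times the mean of [Z], which is at most 1. *)
  pose B := lambda * sz%:R - 2 / theta.
  have iB : P.-integrable setT (fun=> B%:E) by exact: finite_measure_integrable_cst.
  have intB : (\int[P]_w B%:E = B%:E)%E.
    rewrite integral_cst//.
    exact: etrans (congr1 (fun x => B%:E * x)%E (probability_setT P)) (mule1 _).
  have iZ' : P.-integrable setT (fun w => (2 / theta)%:E * (Z w)%:E)%E.
    exact: integrableZl.
  apply: (@le_trans _ _ (\int[P]_w ((log_ratio p Xstar S Y (DA.1 *m DA.2) w)%:E
     + B%:E + (2 / theta)%:E * (Z w)%:E))%E); last first.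
    rewrite integralD//; last exact: integrableD.
    rewrite integralD// intL intB integralZl//.
    have Zfin := integrable_fin_num measurableT iZ.
    rewrite -(fineK Zfin) -EFinM -!EFinD lee_fin.
    have : fine (\int[P]_w (Z w)%:E)%E <= 1 by rewrite -lee_fin fineK.
    have t2 : 0 <= 2 / theta by rewrite divr_ge0// ltW.
    move=> /(ler_wpM2l t2); rewrite /B; lra.
  rewrite -integralZl//; apply: ae_le_integral.
  - exact: integrableZl.
  - apply: integrableD => //; exact: integrableD.
  (* Positivity is required for all codes at once because the estimator is random; finitely many
     almost sure events still intersect in one. *)
  have : {ae P, forall w, forall c, feasb c -> forall e, e \in S w ->
      0 < p (Xstar e.1 e.2) (Y e.1 e.2 w) /\
      0 < p (((dec c).1 *m (dec c).2) e.1 e.2) (Y e.1 e.2 w)}.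
    apply: filter_forall => c.
    have [/asboolP fc|nfc] := boolP (feasb c); last by apply: nearW => w.
    by apply: filterS (ae_likelihood_gt0 hp mS hP hI hY (KLle _ fc)) => w h _.
  apply: filterS => w pos.
  rewrite -!EFinM -!EFinD lee_fin.
  have Llog (A : 'M[R]_(n1, n2)) : (forall e, e \in S w ->
        0 < p (A e.1 e.2) (Y e.1 e.2 w)) ->
      0 < likelihood p A (S w) (fun i j => Y i j w) /\
      ln (likelihood p A (S w) (fun i j => Y i j w)) =
      \sum_(e in S w) ln (p (A e.1 e.2) (Y e.1 e.2 w)).
    by move=> A0; split; [exact: prodr_gt0|exact: ln_prod].
  have lrE (A : 'M[R]_(n1, n2)) : (forall e, e \in S w ->
        0 < p (Xstar e.1 e.2) (Y e.1 e.2 w) /\ 0 < p (A e.1 e.2) (Y e.1 e.2 w)) ->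
      log_ratio p Xstar S Y A w =
      \sum_(e in S w) ln (p (Xstar e.1 e.2) (Y e.1 e.2 w)) -
      ln (likelihood p A (S w) (fun i j => Y i j w)).
    move=> A0; have [_ ->] := Llog A (fun e eS => (A0 e eS).2).
    rewrite -sumrB [RHS]big_mkcond/=; apply: eq_bigr => e _; rewrite indicE.
    have [eS|eS] := boolP (e \in S w); last by rewrite memNset ?mul0r//=; exact/negP.
    by have [? ?] := A0 e eS; rewrite mem_set// mul1r ln_div.
  have codeP (DA' : 'M[R]_(n1, r) * 'M[R]_(r, n2)) : feasible GD GA Xs DA' ->
      [/\ dec (kappa DA') = DA',
      code_size (kappa DA') = (n1 * r + nnz DA'.2)%N & feasb (kappa DA')].
    by move=> fDA'; have [dk ck] := kappaP _ fDA'.1; split=> //; apply/asboolP; rewrite dk.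
  have [dk ck fk] := codeP _ (hatF w).
  have [dk' ck' fk'] := codeP _ fDA.
  have pos1 := pos _ fk; rewrite dk in pos1.
  have pos2 := pos _ fk'; rewrite dk' in pos2.
  have := (hargmin w).2 _ fDA; rewrite /objective.
  have [L1 _] := Llog _ (fun e eS => (pos1 e eS).2).
  have [L2 _] := Llog _ (fun e eS => (pos2 e eS).2).
  rewrite !lne_EFin// -!EFinN -!EFinD lee_fin.
  rewrite (lrE _ pos2).
  have := lrE _ pos1.
  have [tpos tln] := ln_tilt (p := p) (Xstar := Xstar) (S := S) (Y := Y)
    (X := (DAhat w).1 *m (DAhat w).2) (w := w) mu gamma theta pos1.
  have Zge : q ^+ code_size (kappa (DAhat w)) * F (kappa (DAhat w)) w <= Z w.
    by rewrite /Z (bigD1 (kappa (DAhat w)))//= lerDl sumr_ge0// => c _; rewrite mulr_ge0 ?exprn_ge0.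
  have qpos : 0 < q by rewrite powR_gt0// (lt_le_trans ltr01).
  have Fpos : 0 < F (kappa (DAhat w)) w by rewrite /F fk dk.
  have : ln (q ^+ code_size (kappa (DAhat w)) * F (kappa (DAhat w)) w) <= Z w - 1.
    apply: le_trans (lerB Zge (lexx 1)).
    have := @le_ln1Dx R (q ^+ code_size (kappa (DAhat w)) * F (kappa (DAhat w)) w - 1).
    by rewrite subrKC; apply; rewrite ltrBrDl subrr mulr_gt0 ?exprn_gt0.
  rewrite lnM ?posrE ?exprn_gt0// lnXn// ln_powR ck {1}/F fk dk tln.
  rewrite /G /B /sz.
  set a := log_affinity _ _ _ _; set l := log_ratio _ _ _ _ _ _.
  set l1 := ln (maxn n1 n2)%:R; set l2 := ln (likelihood _ ((DAhat w).1 *m _) _ _).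
  set l3 := ln (likelihood _ (DA.1 *m _) _ _); set s0 := \sum_(e in _) _.
  have t2 : 2 / theta = 2 * (1 + 2 * CD / 3) by rewrite /theta invrK.
  have t2_gt0 : 0 < 2 / theta by rewrite divr_gt0.
  rewrite -[_ *+ (n1 * r + _)]mulr_natr !(natrD _ (n1 * r)) => /(ler_wpM2l (ltW t2_gt0)).
  set k1 := (n1 * r)%:R; set kh := (nnz (DAhat w).2)%:R; set kd := (nnz DA.2)%:R.
  have khge : 0 <= k1 + kh by rewrite addr_ge0.
  (* The lower bound on [lambda] says exactly that the penalty per entry covers the code cost per
     entry. *)
  have lam : 0 <= (lambda - 2 / theta * ((beta + 2) * l1)) * (k1 + kh).
    rewrite mulr_ge0// subr_ge0 t2; apply: le_trans hlambda.
    by rewrite le_eqVlt; apply/orP; left; apply/eqP; rewrite /l1; ring.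
  have -> : 2 / theta * (- (beta + 2) * l1 * (k1 + kh) +
      (- (theta / 2 * l) - theta / 3 * gamma * a)) =
     - (2 / theta * ((beta + 2) * l1)) * (k1 + kh) - l - 2 / 3 * gamma * a.
    by field; rewrite gt_eqF.
  exact: combine_bounds lam.
have intE : (\int[P]_w ((- 2)%:E *
    lne (affinity_mx mu p ((DAhat w).1 *m (DAhat w).2) Xstar)) =
    \int[P]_w (G (DAhat w))%:E)%E.
  by apply: eq_integral => w _; exact: (lne_affinity_mx hp (KLle _ (hatF w))).
rewrite intE; have Gfin := integrable_fin_num measurableT iG.
move: key; rewrite -(fineK Gfin); set g := fine _ => key.
have c_ge0 : 0 <= 8 * CD * ln m%:R / m%:R.
  apply: divr_ge0; last exact: ltW.
  apply: mulr_ge0; first by rewrite mulr_ge0.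
  by rewrite ln_ge0// (ler_nat R 1) (leq_trans _ hm4).
(* A third of the normalized risk is bounded by every member of the set under the infimum; the
   factor 3 and the nonnegative [ln m / m] term are restored afterwards. *)
suff : ((g / (3 * (n1 * n2)%:R))%:E <= ereal_inf
   [set ((n1 * n2)%:R^-1)%:E * KL_mx mu p Xstar (DA.1 *m DA.2)
               + ((lambda + 4 * CD * (beta + 2) * ln (maxn n1 n2)%:R / 3)
                  * ((n1 * r + @nnz R r n2 DA.2)%:R / m%:R))%:E
          | DA in @feasible R n1 n2 r GD GA Xs])%E.
  move=> inf_ge; apply: (@le_trans _ _ (3%:E * (g / (3 * (n1 * n2)%:R))%:E)%E).
    rewrite -!EFinM lee_fin le_eqVlt; apply/orP; left; apply/eqP; field.
    by rewrite ?gt_eqF ?ltr0n.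
  apply: (le_trans (lee_wpmul2l _ inf_ge)); first by rewrite lee_fin.
  by rewrite leeDr// lee_fin.
apply/ereal_infP => _ [DA fDA <-].
rewrite (KL_mxE hp (KLle _ fDA)).
have := key _ fDA; rewrite -!EFinM -!EFinD !lee_fin.
set K := \sum_e _; set sz := (_ + _)%:R => h.
have X0 : 0 <= 4 * CD * (beta + 2) * ln (maxn n1 n2)%:R / 3 * (sz / m%:R).
  apply: mulr_ge0; last by rewrite divr_ge0// ltW.
  by rewrite divr_ge0// mulr_ge0// mulr_ge0 ?addr_ge0// mulr_ge0.
rewrite [(lambda + _) * _]mulrDl.
apply: (@le_trans _ _ (((n1 * n2)%:R)^-1 * K + lambda * (sz / m%:R))); last first.
  by rewrite lerD2l lerDl.
(* Dividing by [m] turns [gamma] into the reciprocal of [n1 * n2]. *)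
have : m%:R^-1 * (gamma / 3 * g) <= m%:R^-1 * (gamma * K + lambda * sz).
  by rewrite ler_wpM2l// invr_ge0 ltW.
have -> : m%:R^-1 * (gamma / 3 * g) = g / (3 * (n1 * n2)%:R).
  by rewrite /gamma; field; rewrite ?gt_eqF ?ltr0n// (leq_trans _ hm4).
have -> : m%:R^-1 * (gamma * K + lambda * sz) = (n1 * n2)%:R^-1 * K + lambda * (sz / m%:R).
  by rewrite /gamma; field; rewrite ?gt_eqF ?ltr0n// (leq_trans _ hm4).
by [].
Qed.
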